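(* Let $\mathbb D=\{z\in\mathbb C:|z|<1\}$ and let $\mathcal P$ be the set of holomorphic functions $p$ on $\mathbb D$ with $\operatorname{Re} p(z)>0$ for all $z\in\mathbb D$ (no normalization $p(0)=1$ is imposed). For $p\in\mathcal P$ and $0<r<1$ set \[ I_p(r):=\int_0^{2\pi}\left|\frac{z p'(z)}{p(z)}\right|^2\,d\theta,\qquad z=re^{i\theta}. \] Then for every $p\in\mathcal P$ and every $0<r<1$, \[ I_p(r)\le \frac{\pi^3 e^{-2}}{(1-r)^2}. \] Moreover, for each fixed $p\in\mathcal P$, $I_p(r)=o\bigl((1-r)^{-2}\bigr)$ as $r\to1^-$. *)

(* Defs.v *)
From HB Require Import structures.
From mathcomp Require Import all_boot all_order all_algebra.
From mathcomp Require Import complex.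
From mathcomp Require Import all_classical all_reals all_analysis.
Set Implicit Arguments. Unset Strict Implicit. Unset Printing Implicit Defensive.
Import Order.TTheory GRing.Theory Num.Theory ComplexField.
Import numFieldNormedType.Exports.
Local Open Scope classical_set_scope.
Local Open Scope ring_scope.

(* The complex plane C = R[i], seen as a numClosedFieldType so that it gets
   its canonical normed-field (over itself) structure from MathComp-Analysis.
   Derivatives of maps CC R -> CC R are thus complex derivatives. *)
Definition CC (R : realType) : numClosedFieldType := R[i].

Definition holomorphic_on_disc (R : realType) (p : CC R -> CC R) : Prop :=
  forall z : CC R, `|z| < 1 -> derivable p z 1.

Definition classP (R : realType) (p : CC R -> CC R) : Prop :=
  holomorphic_on_disc p /\ forall z : CC R, `|z| < 1 -> 0 < complex.Re (p z).

Definition polar (R : realType) (r t : R) : CC R := Complex (r * cos t) (r * sin t).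

Definition Ip (R : realType) (p : CC R -> CC R) (r : R) : R :=
  Rintegral (@lebesgue_measure R) `[0, 2 * pi]%classic
    (fun t => Normc.normc (polar r t * derive1 p (polar r t) / p (polar r t)) ^+ 2).

(* Main.v *)
Require Import Defs.
From HB Require Import structures.
From mathcomp Require Import all_boot all_order all_algebra.
From mathcomp Require Import complex.
From mathcomp Require Import all_classical all_reals all_analysis.
From mathcomp Require Import ring lra.
Import Order.TTheory GRing.Theory Num.Theory ComplexField.
Import numFieldNormedType.Exports.
Set Implicit Arguments.
Unset Strict Implicit.
Unset Printing Implicit Defensive.
Local Open Scope classical_set_scope.
Local Open Scope ring_scope.

(* Since Re p > 0, q = log p is holomorphic with |Im q| < pi/2.  Write
   q = sum a_n z^n.  Bessel's inequality for Im q gives sum_(n >= 1) |a_n|^2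
   <= pi^2 / 2, Parseval's identity gives
   I_p(r) = 2 pi sum_(n >= 1) n^2 |a_n|^2 r^(2n), and n (1 - r) r^n <= 1/e;
   the o-estimate follows by splitting the sum.
   In the coordinates z = exp (s + i t), s < 0, we have |z p' / p|^2
   = |d_s Im q|^2 + |d_s Re q|^2.  That the Fourier coefficients of q(s, .) are
   constant multiples of e^(ns) is Goursat's theorem applied to q e^(-nz) on the
   rectangles [s, s'] x [0, 2 pi].  To avoid the regularity of q', the
   Parseval bound is obtained from difference quotients in s, through pointwise
   convergence of Fourier series and Fatou's lemma. *)

(** * Total differentiability in two real variables *)

(** Holomorphy is given only as complex differentiability at each point, with no control of how the
    derivative varies. Every analytic step therefore rests on pointwise total differentiability of
    pairs of real functions. Of the two parts of log p, only Im q is bounded. Re q may be unbounded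
    near the circle, and it is reached through its Fourier coefficients, which the Cauchy-Riemann
    equations tie to those of Im q. The chart exp (s + i t) turns the centre of the disc into s =
    -oo, and boundedness there is what excludes negative frequencies. The constant term a_0 does not
    depend on s, so it drops out of every difference quotient in s; this is why the value of p (0)
    is immaterial. The final constant is 2 pi * (e^(-2) / (1 - r)^2) * (pi^2 / 2), where pi^2 / 2 =
    (1 / pi) * (pi / 2)^2 * 2 pi is the bound on |Im q| integrated over the circle. *)

Section total_differential.
Variable R : realType.
Implicit Types (F u v X Y : R -> R -> R) (f g : R -> R).

(** Total differentiability at a point, with partial derivatives [a] and [b]. Complex
    differentiability yields exactly this, and unlike the mere existence of partial derivatives it
    is stable under composition. *)
Definition fdiff u (s t a b : R) : Prop :=
  forall e : R, 0 < e -> exists2 d : R, 0 < d &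
    forall x y, `|x - s| < d -> `|y - t| < d ->
      `|u x y - u s t - (a * (x - s) + b * (y - t))|
        <= e * (`|x - s| + `|y - t|).

(** Absorbs a fixed factor [C] into the error, so that a composite estimate can be carried out
    without tuning its epsilons in advance. *)
Lemma fdiff_bigO u s t a b (C : R) : 0 <= C ->
  (forall e : R, 0 < e <= 1 -> exists2 d : R, 0 < d &
    forall x y, `|x - s| < d -> `|y - t| < d ->
      `|u x y - u s t - (a * (x - s) + b * (y - t))|
        <= C * e * (`|x - s| + `|y - t|)) -> fdiff u s t a b.
Proof.
move=> C0 H e e0.
have D0 : 0 < C + 1 by lra.
have [|d d0 Hd] := H (Num.min 1 (e / (C + 1))).
  by rewrite lt_min ltr01 divr_gt0//= ge_min lexx.
exists d => // x y xs yt; apply: (le_trans (Hd x y xs yt)).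
apply: ler_wpM2r; first by rewrite addr_ge0.
apply: (@le_trans _ _ (C * (e / (C + 1)))).
  by apply: ler_wpM2l => //; rewrite ge_min lexx orbT.
by rewrite mulrA ler_pdivrMr// mulrDr mulr1; lra.
Qed.

(** The definition with error 1. It controls the inner increments in the chain rule and later bounds
    log |p| near the centre of the disc. *)
Lemma fdiff_lipschitz u s t a b : fdiff u s t a b ->
  exists2 d : R, 0 < d & forall x y, `|x - s| < d -> `|y - t| < d ->
    `|u x y - u s t| <= (`|a| + `|b| + 1) * (`|x - s| + `|y - t|).
Proof.
move=> /(_ 1 ltr01)[d d0 H]; exists d => // x y xs yt.
rewrite -[X in `|X|](subrK (a * (x - s) + b * (y - t))).
apply: (le_trans (ler_normD _ _)).
have H1 := H x y xs yt.
have H2 : `|a * (x - s) + b * (y - t)| <= `|a| * `|x - s| + `|b| * `|y - t|.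
  by rewrite -!normrM ler_normD.
have := mulr_ge0 (normr_ge0 a) (normr_ge0 (y - t)).
have := mulr_ge0 (normr_ge0 b) (normr_ge0 (x - s)).
lra.
Qed.

(** The only chain rule proved by hand: sums, products and one-variable outer functions are all
    obtained by a choice of [F]. *)
Lemma fdiff_comp F X Y (s t F1 F2 X1 X2 Y1 Y2 : R) :
  fdiff F (X s t) (Y s t) F1 F2 -> fdiff X s t X1 X2 -> fdiff Y s t Y1 Y2 ->
  fdiff (fun x y => F (X x y) (Y x y)) s t
    (F1 * X1 + F2 * Y1) (F1 * X2 + F2 * Y2).
Proof.
move=> hF hX hY.
have [dX dX0 lX] := fdiff_lipschitz hX.
have [dY dY0 lY] := fdiff_lipschitz hY.
pose KX := `|X1| + `|X2| + 1; pose KY := `|Y1| + `|Y2| + 1.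
have KX0 : 0 < KX by rewrite /KX; have := normr_ge0 X1; have := normr_ge0 X2; lra.
have KY0 : 0 < KY by rewrite /KY; have := normr_ge0 Y1; have := normr_ge0 Y2; lra.
apply: (@fdiff_bigO _ _ _ _ _ (KX + KY + (`|F1| + `|F2|))).
  by rewrite !addr_ge0// ltW.
move=> e /andP[e0 _].
have [dF dF0 HF] := hF e e0.
have [d1 d10 H1] := hX e e0.
have [d2 d20 H2] := hY e e0.
(* The first four radii serve the Lipschitz and first-order bounds of the inner functions. The last
   two keep both inner increments below [dF]: two terms smaller than dF / (2 KX) give KX (|x - s| +
   |y - t|) < dF, and likewise for [KY]. *)
pose d := Num.min (Num.min (Num.min dX dY) (Num.min d1 d2))
  (Num.min (dF / (2 * KX)) (dF / (2 * KY))).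
have d0 : 0 < d by rewrite !lt_min dX0 dY0 d10 d20 !divr_gt0// mulr_gt0.
exists d => // x y xd yd.
move: (xd) (yd); rewrite /d !lt_min.
move=> /andP[/andP[/andP[x1 x2] /andP[x3 x4]] /andP[x5 x6]].
move=> /andP[/andP[/andP[y1 y2] /andP[y3 y4]] /andP[y5 y6]].
clear xd yd.
move: (lX x y x1 y1) (lY x y x2 y2) (H1 x y x3 y3) (H2 x y x4 y4).
rewrite -/KX -/KY => LX LY EX EY.
move: (`|x - s|) (`|y - t|) (normr_ge0 (x - s)) (normr_ge0 (y - t))
  x5 y5 x6 y6 LX LY EX EY {x1 x2 x3 x4 y1 y2 y3 y4}
  => p q p0 q0 x5 y5 x6 y6 LX LY EX EY.
have pq0 : 0 <= p + q by rewrite addr_ge0.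
rewrite ltr_pdivlMr in x5; last by rewrite mulr_gt0.
rewrite ltr_pdivlMr in y5; last by rewrite mulr_gt0.
rewrite ltr_pdivlMr in x6; last by rewrite mulr_gt0.
rewrite ltr_pdivlMr in y6; last by rewrite mulr_gt0.
have DX : `|X x y - X s t| < dF by apply: (le_lt_trans LX); lra.
have DY : `|Y x y - Y s t| < dF by apply: (le_lt_trans LY); lra.
have HFF := HF _ _ DX DY.
have HFF' : `|F (X x y) (Y x y) - F (X s t) (Y s t) -
   (F1 * (X x y - X s t) + F2 * (Y x y - Y s t))| <= e * ((KX + KY) * (p + q)).
  by apply: (le_trans HFF); apply: ler_wpM2l; [exact: ltW|rewrite mulrDl lerD].
rewrite (_ : _ - _ = (F (X x y) (Y x y) - F (X s t) (Y s t) -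
   (F1 * (X x y - X s t) + F2 * (Y x y - Y s t))) +
   (F1 * (X x y - X s t - (X1 * (x - s) + X2 * (y - t))) +
    F2 * (Y x y - Y s t - (Y1 * (x - s) + Y2 * (y - t))))); last by ring.
apply: (le_trans (ler_normD _ _)).
apply: (@le_trans _ _ (e * ((KX + KY) * (p + q)) +
  (`|F1| * (e * (p + q)) + `|F2| * (e * (p + q))))).
  apply: lerD => //; apply: (le_trans (ler_normD _ _)).
  by rewrite !normrM; apply: lerD; apply: ler_wpM2l.
rewrite le_eqVlt; apply/orP; left; apply/eqP; ring.
Qed.

Lemma fdiff_fst s t : fdiff (fun x _ => x) s t 1 0.
Proof.
move=> e e0; exists 1 => // x y _ _.
rewrite [X in `|X|](_ : _ = 0); last by ring.
by rewrite normr0 mulr_ge0 ?addr_ge0// ltW.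
Qed.

Lemma fdiff_snd s t : fdiff (fun _ y => y) s t 0 1.
Proof.
move=> e e0; exists 1 => // x y _ _.
rewrite [X in `|X|](_ : _ = 0); last by ring.
by rewrite normr0 mulr_ge0 ?addr_ge0// ltW.
Qed.

Lemma fdiff_cst c s t : fdiff (fun _ _ => c) s t 0 0.
Proof.
move=> e e0; exists 1 => // x y _ _.
rewrite [X in `|X|](_ : _ = 0); last by ring.
by rewrite normr0 mulr_ge0 ?addr_ge0// ltW.
Qed.

Lemma fdiff_add s t : fdiff +%R s t 1 1.
Proof.
move=> e e0; exists 1 => // x y _ _.
rewrite [X in `|X|](_ : _ = 0); last by ring.
by rewrite normr0 mulr_ge0 ?addr_ge0// ltW.
Qed.

Lemma fdiff_mul s t : fdiff *%R s t t s.
Proof.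
move=> e e0; exists e => // x y xs yt.
rewrite [X in `|X|](_ : _ = (x - s) * (y - t)); last by ring.
rewrite normrM mulrDr ler_wpDr ?mulr_ge0 ?(ltW e0)// mulrC ler_wpM2r//; exact: ltW.
Qed.

Lemma is_derive_lin f (x l : R) : is_derive x 1 f l ->
  forall e : R, 0 < e -> exists2 d : R, 0 < d & forall y, `|y - x| < d ->
    `|f y - f x - l * (y - x)| <= e * `|y - x|.
Proof.
move=> [fd fl] e e0.
have /cvgrPdist_le/(_ e e0) := fd.
move: fl; rewrite /derive => -> [d/= d0 H].
exists d => // y yx; have [->|yNx] := eqVneq y x.
  by rewrite !subrr mulr0 subrr normr0 mulr0.
have h0 : y - x != 0 by rewrite subr_eq0.
have := H (y - x); rewrite /ball_/= sub0r normrN => /(_ yx h0).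
rewrite /GRing.scale/= mulr1 subrK => {}H.
rewrite [X in `|X|](_ : _ = - ((y - x) * (l - (y - x)^-1 * (f y - f x)))); last by field.
by rewrite normrN normrM mulrC ler_wpM2r.
Qed.

Lemma fdiff_fun1 f u s t l a b : is_derive (u s t) 1 f l -> fdiff u s t a b ->
  fdiff (fun x y => f (u x y)) s t (l * a) (l * b).
Proof.
move=> fl hu.
(* The outer function ignores its second argument, so [u] can fill both slots of the chain rule. *)
have hf : fdiff (fun x _ => f x) (u s t) (u s t) l 0.
  move=> e e0; have [d d0 H] := is_derive_lin fl e0; exists d => // x y xs _.
  rewrite mul0r addr0; apply: (le_trans (H x xs)).
  by apply: ler_wpM2l; [exact: ltW|rewrite lerDl].
have := fdiff_comp hf hu hu.
by rewrite !mul0r !addr0.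
Qed.

Lemma fdiffD u v s t a b c d : fdiff u s t a b -> fdiff v s t c d ->
  fdiff (fun x y => u x y + v x y) s t (a + c) (b + d).
Proof.
by move=> hu hv; have := fdiff_comp (@fdiff_add _ _) hu hv; rewrite !mul1r.
Qed.

Lemma fdiffM u v s t a b c d : fdiff u s t a b -> fdiff v s t c d ->
  fdiff (fun x y => u x y * v x y) s t (a * v s t + u s t * c)
    (b * v s t + u s t * d).
Proof.
move=> hu hv; have := fdiff_comp (@fdiff_mul _ _) hu hv.
by rewrite ![v s t * _]mulrC.
Qed.

Lemma fdiffN u s t a b : fdiff u s t a b ->
  fdiff (fun x y => - u x y) s t (- a) (- b).
Proof.
move=> hu; have := fdiffM (fdiff_cst (-1) s t) hu.
rewrite !mul0r !add0r !mulN1r.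
by congr fdiff; apply/funext => x; apply/funext => y; rewrite mulN1r.
Qed.

Lemma fdiffB u v s t a b c d : fdiff u s t a b -> fdiff v s t c d ->
  fdiff (fun x y => u x y - v x y) s t (a - c) (b - d).
Proof. by move=> hu hv; exact/fdiffD/fdiffN. Qed.

Lemma fdiff_derive1 u s t a b : fdiff u s t a b -> is_derive s 1 (u^~ t) a.
Proof.
move=> hu.
suff H : (fun h => h^-1 *: (u (h *: 1 + s) t - u s t)) @ 0^' --> a.
  by apply: DeriveDef; [apply/cvg_ex; exists a|exact: cvg_lim].
apply/cvgrPdist_le => e e0; have [d d0 H] := hu e e0.
exists d => //= h; rewrite /ball_/= sub0r normrN => hd h0.
rewrite /GRing.scale/= mulr1.
have := H (h + s) t; rewrite addrK !subrr normr0 mulr0 !addr0 => /(_ hd d0) K.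
rewrite -(ler_pM2r (_ : 0 < `|h|)) ?normr_gt0// -normrM.
rewrite (_ : _ * h = - (u (h + s) t - u s t - a * h)) ?normrN//.
by field.
Qed.

Lemma fdiff_swap u s t a b : fdiff u s t a b -> fdiff (fun x y => u y x) t s b a.
Proof.
move=> hu e e0; have [d d0 H] := hu e e0; exists d => // x y xt ys.
by have := H y x ys xt; rewrite [a * _ + _]addrC [`|y - s| + _]addrC.
Qed.

Lemma fdiff_derive2 u s t a b : fdiff u s t a b -> is_derive t 1 (u s) b.
Proof. by move=> /fdiff_swap/fdiff_derive1. Qed.

Lemma is_derive_continuous f (x l : R) : is_derive x 1 f l -> {for x, continuous f}.
Proof. by case=> df _; apply: differentiable_continuous; apply/derivable1_diffP. Qed.

End total_differential.

(** * Integrals over segments *)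

Section segment_integral.
Variable R : realType.
Implicit Types f g : R -> R.
Local Notation mu := (@lebesgue_measure R).

Definition itg (a b : R) f : R := \int[mu]_(x in `[a, b]) f x.

(** Continuity in the ambient line, two-sided even at the end points: pointwise limits then combine
    directly, and all functions integrated here satisfy it. *)
Definition ctson (a b : R) f := forall x, a <= x <= b -> {for x, continuous f}.

Lemma ctson_within a b f : ctson a b f -> {within `[a, b], continuous f}.
Proof.
by move=> cf; apply: continuous_in_subspaceT => x; rewrite inE/= in_itv/=; exact: cf.
Qed.

Lemma ctson_integrable a b f : ctson a b f ->
  mu.-integrable `[a, b] (EFin \o f).
Proof.
move=> cf; apply: continuous_compact_integrable; first exact: segment_compact.
exact: ctson_within.
Qed.

Lemma ctsonT a b f : continuous f -> ctson a b f.
Proof. by move=> cf x _; exact: cf. Qed.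

Lemma ctsonS a b c d f : a <= c -> d <= b -> ctson a b f -> ctson c d f.
Proof.
by move=> ac db cf x /andP[cx xd]; apply: cf; rewrite (le_trans ac)// (le_trans xd).
Qed.

Lemma ctsonD a b f g : ctson a b f -> ctson a b g -> ctson a b (fun x => f x + g x).
Proof. by move=> cf cg x xab; apply: cvgD; [exact: cf|exact: cg]. Qed.

Lemma ctsonN a b f : ctson a b f -> ctson a b (fun x => - f x).
Proof. by move=> cf x xab; apply: cvgN; exact: cf. Qed.

Lemma ctsonB a b f g : ctson a b f -> ctson a b g -> ctson a b (fun x => f x - g x).
Proof. by move=> cf cg; exact/ctsonD/ctsonN. Qed.

Lemma ctsonM a b f g : ctson a b f -> ctson a b g -> ctson a b (fun x => f x * g x).
Proof. by move=> cf cg x xab; apply: cvgM; [exact: cf|exact: cg]. Qed.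

Lemma ctson_cst a b (c : R) : ctson a b (fun=> c).
Proof. by move=> x _; exact: cvg_cst. Qed.

Lemma ctson_sum a b n (F : nat -> R -> R) :
  (forall i, ctson a b (F i)) -> ctson a b (fun x => \sum_(i < n) F i x).
Proof.
move=> cF; elim: n => [|n IH].
  rewrite (_ : (fun x => _) = fun=> 0); first exact: ctson_cst.
  by apply/funext => x; rewrite big_ord0.
rewrite (_ : (fun x => _) = (fun x => \sum_(i < n) F i x + F n x)).
  exact: ctsonD.
by apply/funext => x; rewrite big_ord_recr.
Qed.

Lemma eq_itg a b f g : (forall x, a <= x <= b -> f x = g x) -> itg a b f = itg a b g.
Proof. by move=> fg; apply: eq_Rintegral => x; rewrite inE/= in_itv/=; exact: fg. Qed.

Lemma itgD a b f g : ctson a b f -> ctson a b g ->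
  itg a b (fun x => f x + g x) = itg a b f + itg a b g.
Proof. by move=> cf cg; rewrite /itg RintegralD//; exact: ctson_integrable. Qed.

Lemma itgB a b f g : ctson a b f -> ctson a b g ->
  itg a b (fun x => f x - g x) = itg a b f - itg a b g.
Proof. by move=> cf cg; rewrite /itg RintegralB//; exact: ctson_integrable. Qed.

Lemma itgZ a b c f : ctson a b f -> itg a b (fun x => c * f x) = c * itg a b f.
Proof. by move=> cf; rewrite /itg RintegralZl//; exact: ctson_integrable. Qed.

Lemma itgN a b f : ctson a b f -> itg a b (fun x => - f x) = - itg a b f.
Proof.
move=> cf; rewrite -mulN1r -itgZ//.
by apply: eq_itg => x _; rewrite mulN1r.
Qed.

Lemma itg_cst a b c : a <= b -> itg a b (fun=> c) = c * (b - a).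
Proof.
move=> ab; rewrite /itg Rintegral_cst//= lebesgue_measure_itv/= lte_fin.
by case: ltgtP ab => //= -> _; rewrite subrr.
Qed.

Lemma itg_sum a b n (F : nat -> R -> R) :
  a <= b -> (forall i, ctson a b (F i)) ->
  itg a b (fun x => \sum_(i < n) F i x) = \sum_(i < n) itg a b (F i).
Proof.
move=> ab cF; elim: n => [|n IH].
  rewrite big_ord0 -[RHS](mul0r (b - a)) -itg_cst//.
  by apply: eq_itg => x _; rewrite big_ord0.
rewrite big_ord_recr/= -IH -itgD//; last exact: ctson_sum.
by apply: eq_itg => x _; rewrite big_ord_recr.
Qed.

Lemma itg_le a b f g : ctson a b f -> ctson a b g ->
  (forall x, a <= x <= b -> f x <= g x) -> itg a b f <= itg a b g.
Proof.
move=> cf cg fg; apply: le_Rintegral => //; exact: ctson_integrable.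
Qed.

Lemma itg_ge0 a b f : (forall x, a <= x <= b -> 0 <= f x) -> 0 <= itg a b f.
Proof. by move=> f0; apply: Rintegral_ge0 => x/=; rewrite in_itv/=; exact: f0. Qed.

Lemma itg_norm_le a b f K : a <= b -> ctson a b f ->
  (forall x, a <= x <= b -> `|f x| <= K) -> `|itg a b f| <= K * (b - a).
Proof.
move=> ab cf fK; rewrite -itg_cst// ler_norml; apply/andP; split.
  rewrite lerNl -itgN//; apply: itg_le; [exact: ctsonN|exact: ctson_cst|].
  by move=> x /fK; rewrite ler_norml lerNl => /andP[].
apply: itg_le => //; first exact: ctson_cst.
by move=> x /fK; rewrite ler_norml => /andP[].
Qed.

Lemma itg_split a b c f : a <= c -> c <= b -> ctson a b f ->
  itg a b f = itg a c f + itg c b f.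
Proof.
move=> ac cb cf; apply/eqP; rewrite addrC -subr_eq; apply/eqP.
rewrite /itg (@Rintegral_itvB R f (BLeft a) (BRight b) c) ?bnd_simp//; last first.
  exact: ctson_integrable.
rewrite Rintegral_itv_obnd_cbnd//.
apply: (@integrableS _ _ _ mu `[a, b]) => //; last exact: ctson_integrable.
by apply: subset_itv; rewrite ?bnd_simp.
Qed.

End segment_integral.

(** * Goursat's theorem for closed forms *)

Section goursat.
Variable R : realType.

(** The supremum of the left end points works, every right end point being an upper bound of
    them. *)
Lemma nested_segments (X W : nat -> R) : (forall n, 0 <= W n) ->
  (forall n, X n <= X n.+1) -> (forall n, X n.+1 + W n.+1 <= X n + W n) ->
  exists s, forall n, X n <= s <= X n + W n.
Proof.
move=> W0 nX nW.
have mX m n : (m <= n)%N -> X m <= X n.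
  by apply: (@homo_leq _ X (fun x y => x <= y)) => //; exact: le_trans.
have mW m n : (m <= n)%N -> X n + W n <= X m + W m.
  apply: (@homo_leq _ (fun k => X k + W k) (fun x y => y <= x)) => //.
  by move=> x y z yx zy; exact: le_trans zy yx.
have ub n : ubound (range X) (X n + W n).
  move=> _ [m _ <-]; apply: (@le_trans _ _ (X (maxn m n))).
    by apply: mX; rewrite leq_maxl.
  apply: (@le_trans _ _ (X (maxn m n) + W (maxn m n))); first by rewrite lerDl.
  by apply: mW; rewrite leq_maxr.
exists (sup (range X)) => n; apply/andP; split.
  apply: ub_le_sup; last by exists n.
  by exists (X 0%N + W 0%N); exact: ub.
by apply: ge_sup; [exists (X 0%N), 0%N|exact: ub].
Qed.

Lemma exp2_gt (x : R) : exists n : nat, x < 2 ^+ n.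
Proof.
exists (Num.bound x); apply: (le_lt_trans (ler_norm x)).
have := archi_boundP (normr_ge0 x); rewrite /Num.bound normr_id => /lt_trans; apply.
by rewrite -natrX ltr_nat ltn_expl.
Qed.

(** An additive function of rectangles that is o(diameter^2) at every point vanishes. If not,
    repeated quartering keeps a quarter of the value each time, hence at least |B| / 4^n on a
    rectangle of size K / 2^n, against the local bound at the limit point. *)
Lemma rectangle_bisection (B : R -> R -> R -> R -> R) (a b c d : R) :
  a <= b -> c <= d ->
  (forall x0 x1 x2 y0 y1, a <= x0 -> x0 <= x1 -> x1 <= x2 -> x2 <= b ->
    c <= y0 -> y0 <= y1 -> y1 <= d ->
    B x0 x2 y0 y1 = B x0 x1 y0 y1 + B x1 x2 y0 y1) ->
  (forall x0 x1 y0 y1 y2, a <= x0 -> x0 <= x1 -> x1 <= b ->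
    c <= y0 -> y0 <= y1 -> y1 <= y2 -> y2 <= d ->
    B x0 x1 y0 y2 = B x0 x1 y0 y1 + B x0 x1 y1 y2) ->
  (forall s t, a <= s <= b -> c <= t <= d -> forall e, 0 < e ->
    exists2 r, 0 < r & forall x0 x1 y0 y1, a <= x0 -> x0 <= s <= x1 -> x1 <= b ->
      c <= y0 -> y0 <= t <= y1 -> y1 <= d -> x1 - x0 < r -> y1 - y0 < r ->
      `|B x0 x1 y0 y1| <= e * (x1 - x0 + (y1 - y0)) ^+ 2) ->
  B a b c d = 0.
Proof.
move=> ab cd Bx By Bloc; apply/eqP; apply/negP => /negP B0.
pose w n : R := (b - a) / 2 ^+ n; pose h n : R := (d - c) / 2 ^+ n.
have w0 n : 0 <= w n by rewrite divr_ge0 ?subr_ge0 ?exprn_ge0.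
have h0 n : 0 <= h n by rewrite divr_ge0 ?subr_ge0 ?exprn_ge0.
have wS n : w n = w n.+1 + w n.+1.
  by rewrite /w exprS; field; rewrite expf_neq0.
have hS n : h n = h n.+1 + h n.+1.
  by rewrite /h exprS; field; rewrite expf_neq0.
pose val n (p : R * R) := `|B p.1 (p.1 + w n) p.2 (p.2 + h n)|.
pose ok n (p : R * R) :=
  [/\ a <= p.1, p.1 + w n <= b, c <= p.2 & p.2 + h n <= d].
(* The assumption [ok n p] sits under the existential so that the axiom of choice gives a selection
   defined on all pairs, which can then be iterated. *)
have step n p : exists q : R * R, ok n p ->
  [/\ ok n.+1 q, p.1 <= q.1 /\ q.1 + w n.+1 <= p.1 + w n,
      p.2 <= q.2 /\ q.2 + h n.+1 <= p.2 + h n & val n p / 4 <= val n.+1 q].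
  case: p => x y.
  have [H|/not_implyP[[/= ax xb cy yd] _]] := pselect (ok n (x, y) -> False).
    by exists (x, y).
  have w1 := w0 n.+1; have h1 := h0 n.+1; have wn := wS n; have hn := hS n.
  set x' := x + w n.+1; set y' := y + h n.+1.
  have E : B x (x + w n) y (y + h n) =
      (B x (x + w n.+1) y (y + h n.+1) + B x (x + w n.+1) y' (y' + h n.+1)) +
      (B x' (x' + w n.+1) y (y + h n.+1) + B x' (x' + w n.+1) y' (y' + h n.+1)).
    rewrite (_ : x + w n = x' + w n.+1); last by rewrite /x'; lra.
    rewrite (_ : y + h n = y' + h n.+1); last by rewrite /y'; lra.
    rewrite (Bx x x'); [|rewrite /x' /y'; clear - ax xb cy yd w1 h1 wn hn; lra..].
    rewrite (By x _ y y'); [|rewrite /x' /y'; clear - ax xb cy yd w1 h1 wn hn; lra..].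
    by rewrite (By x' _ y y'); [|rewrite /x' /y'; clear - ax xb cy yd w1 h1 wn hn; lra..].
  have : val n (x, y) <= (val n.+1 (x, y) + val n.+1 (x, y')) +
      (val n.+1 (x', y) + val n.+1 (x', y')).
    rewrite /val/= E; apply: (le_trans (ler_normD _ _)).
    by apply: lerD; exact: ler_normD.
  have [H1|H1] := leP (val n (x, y) / 4) (val n.+1 (x, y)).
    by exists (x, y) => _; split; rewrite /ok/= /x' /y' //;
      clear - ax xb cy yd w1 h1 wn hn; split; lra.
  have [H2|H2] := leP (val n (x, y) / 4) (val n.+1 (x, y')).
    by exists (x, y') => _; split; rewrite /ok/= /x' /y' //;
      clear - ax xb cy yd w1 h1 wn hn; split; lra.
  have [H3|H3] := leP (val n (x, y) / 4) (val n.+1 (x', y)).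
    by exists (x', y) => _; split; rewrite /ok/= /x' /y' //;
      clear - ax xb cy yd w1 h1 wn hn; split; lra.
  move=> H; exists (x', y') => _; split; last by move: H1 H2 H3 H; clear; lra.
  - by rewrite /ok/= /x' /y'; clear - ax xb cy yd w1 h1 wn hn; split; lra.
  - by rewrite /= /x'; clear - w1 wn; split; lra.
  - by rewrite /= /y'; clear - h1 hn; split; lra.
have /choice[f Hf] : forall np : nat * (R * R), exists q : R * R, ok np.1 np.2 ->
  [/\ ok np.1.+1 q, np.2.1 <= q.1 /\ q.1 + w np.1.+1 <= np.2.1 + w np.1,
      np.2.2 <= q.2 /\ q.2 + h np.1.+1 <= np.2.2 + h np.1 &
      val np.1 np.2 / 4 <= val np.1.+1 q].
  by case=> n p; exact: step.
pose S := fix S n := if n is m.+1 then f (m, S m) else (a, c).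
have S0ok : ok 0%N (S 0%N).
  by rewrite /ok/= /w /h expr0 !divr1; split => //; lra.
have Sok n : ok n (S n).
  by elim: n => // n IH; have [] := Hf (n, S n) IH.
have SB n : `|B a b c d| / 4 ^+ n <= val n (S n).
  elim: n => [|n IH].
    by rewrite /val/= /w /h !expr0 !divr1 [a + _]addrC [c + _]addrC !subrK.
  have [_ _ _ /= H] := Hf (n, S n) (Sok n).
  apply: le_trans H; rewrite exprSr invfM mulrA ler_wpM2r//.
have [s Hs] : exists s, forall n, (S n).1 <= s <= (S n).1 + w n.
  by apply: nested_segments => // n; have [_ [? ?] _ _] := Hf (n, S n) (Sok n).
have [t Ht] : exists t, forall n, (S n).2 <= t <= (S n).2 + h n.
  by apply: nested_segments => // n; have [_ _ [? ?] _] := Hf (n, S n) (Sok n).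
have sab : a <= s <= b.
  by have := Hs 0%N; rewrite /= /w expr0 divr1 [a + _]addrC subrK.
have tcd : c <= t <= d.
  by have := Ht 0%N; rewrite /= /h expr0 divr1 [c + _]addrC subrK.
pose K := b - a + (d - c).
have K0 : 0 <= K by rewrite addr_ge0// subr_ge0.
have K1 : 0 < K ^+ 2 + 1 by rewrite ltr_wpDl// sqr_ge0.
have eta0 : 0 < `|B a b c d| by rewrite normr_gt0.
(* This error makes the upper bound |B| K^2 / (K^2 + 1) / 4^n, strictly below the lower bound |B| /
   4^n; the added 1 also covers K = 0. *)
have [r r0 Hr] := Bloc s t sab tcd (`|B a b c d| / (K ^+ 2 + 1)) (divr_gt0 eta0 K1).
have [n] := exp2_gt (K / r); rewrite ltr_pdivrMr// => Kn.
have e2 : 0 < 2 ^+ n :> R by rewrite exprn_gt0.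
have wn : w n < r by rewrite ltr_pdivrMr// mulrC; rewrite /K in Kn; lra.
have hn : h n < r by rewrite ltr_pdivrMr// mulrC; rewrite /K in Kn; lra.
have [a1 a2 a3 a4] := Sok n.
have := Hr _ _ _ _ a1 (Hs n) a2 a3 (Ht n) a4.
rewrite ![_ + _ - (S n).1]addrC ![_ + _ - (S n).2]addrC !addKr => /(_ wn hn).
apply/negP; rewrite -ltNge; apply: lt_le_trans (SB n).
rewrite (_ : w n + h n = K / 2 ^+ n); last by rewrite /w /h /K; field; rewrite expf_neq0.
have E4 : (2 ^+ n) ^+ 2 = 4 ^+ n :> R.
  by rewrite -exprM mulnC exprM; congr (_ ^+ _); ring.
rewrite expr_div_n E4.
rewrite mulrA ltr_pM2r ?invr_gt0 ?exprn_gt0// mulrAC ltr_pdivrMr// ltr_pM2l//.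
by rewrite ltrDl.
Qed.

(** The counterclockwise line integral of the form P dx + Q dy. *)
Definition boundary_itg (P Q : R -> R -> R) (x0 x1 y0 y1 : R) : R :=
  itg x0 x1 (P^~ y0) - itg x0 x1 (P^~ y1) + (itg y0 y1 (Q x1) - itg y0 y1 (Q x0)).

(* The partial derivatives of P and Q need not be continuous, so Green's
   formula is not available: the bisection argument replaces it. *)
Lemma goursat (P Q : R -> R -> R) (a b c d : R) : a <= b -> c <= d ->
  (forall s t, a <= s <= b -> c <= t <= d ->
    exists p k q, fdiff P s t p k /\ fdiff Q s t k q) ->
  boundary_itg P Q a b c d = 0.
Proof.
move=> ab cd PQ.
have cP t x0 x1 : c <= t <= d -> a <= x0 -> x1 <= b -> ctson x0 x1 (P^~ t).
  move=> tcd ax xb; apply: ctsonS ax xb _ => x xab.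
  have [p [k [q [hP _]]]] := PQ x t xab tcd.
  exact: is_derive_continuous (fdiff_derive1 hP).
have cQ s y0 y1 : a <= s <= b -> c <= y0 -> y1 <= d -> ctson y0 y1 (Q s).
  move=> sab cy yd; apply: ctsonS cy yd _ => y ycd.
  have [p [k [q [_ hQ]]]] := PQ s y sab ycd.
  exact: is_derive_continuous (fdiff_derive2 hQ).
apply: rectangle_bisection => //.
- move=> x0 x1 x2 y0 y1 *; rewrite /boundary_itg.
  rewrite (@itg_split _ x0 x2 x1 (P^~ y0))//; last by apply: cP => //; lra.
  rewrite (@itg_split _ x0 x2 x1 (P^~ y1))//; last by apply: cP => //; lra.
  by ring.
- move=> x0 x1 y0 y1 y2 *; rewrite /boundary_itg.
  rewrite (@itg_split _ y0 y2 y1 (Q x0))//; last by apply: cQ => //; lra.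
  rewrite (@itg_split _ y0 y2 y1 (Q x1))//; last by apply: cQ => //; lra.
  by ring.
move=> s t sab tcd e e0.
have [p [k [q [hP hQ]]]] := PQ s t sab tcd.
(* Half of [e], because the errors of two opposite sides are added. *)
have e2 : 0 < e / 2 by rewrite divr_gt0.
have [r1 r10 H1] := hP _ e2; have [r2 r20 H2] := hQ _ e2.
exists (Num.min r1 r2); first by rewrite lt_min r10.
move=> x0 x1 y0 y1 ax0 /andP[x0s sx1] x1b cy0 /andP[y0t ty1] y1d.
rewrite !lt_min => /andP[xr1 xr2] /andP[yr1 yr2].
set l := x1 - x0 + (y1 - y0).
have EP x y : x0 <= x <= x1 -> y0 <= y <= y1 ->
    `|P x y - P s t - (p * (x - s) + k * (y - t))| <= e / 2 * l.
  move=> /andP[xx0 xx1] /andP[yy0 yy1].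
  have xs : `|x - s| <= x1 - x0 by rewrite ler_norml; apply/andP; split; clear - x0s sx1 y0t ty1 xx0 xx1 yy0 yy1; lra.
  have yt : `|y - t| <= y1 - y0 by rewrite ler_norml; apply/andP; split; clear - x0s sx1 y0t ty1 xx0 xx1 yy0 yy1; lra.
  apply: (le_trans (H1 x y (le_lt_trans xs xr1) (le_lt_trans yt yr1))).
  by rewrite ler_pM2l// lerD.
have EQ x y : x0 <= x <= x1 -> y0 <= y <= y1 ->
    `|Q x y - Q s t - (k * (x - s) + q * (y - t))| <= e / 2 * l.
  move=> /andP[xx0 xx1] /andP[yy0 yy1].
  have xs : `|x - s| <= x1 - x0 by rewrite ler_norml; apply/andP; split; clear - x0s sx1 y0t ty1 xx0 xx1 yy0 yy1; lra.
  have yt : `|y - t| <= y1 - y0 by rewrite ler_norml; apply/andP; split; clear - x0s sx1 y0t ty1 xx0 xx1 yy0 yy1; lra.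
  apply: (le_trans (H2 x y (le_lt_trans xs xr2) (le_lt_trans yt yr2))).
  by rewrite ler_pM2l// lerD.
have x01 : x0 <= x1 by lra.
have y01 : y0 <= y1 by lra.
have cP0 : ctson x0 x1 (P^~ y0) by apply: cP => //; lra.
have cP1 : ctson x0 x1 (P^~ y1) by apply: cP => //; lra.
have cQ0 : ctson y0 y1 (Q x0) by apply: cQ => //; lra.
have cQ1 : ctson y0 y1 (Q x1) by apply: cQ => //; lra.
(* This is where closedness enters: [k] is both the y-derivative of P and the x-derivative of Q, so
   the two inserted constants contribute opposite multiples of the area. Each one cancels the
   difference of the linear parts on two opposite sides, and only the errors remain. *)
rewrite /boundary_itg (_ : _ + _ =
  itg x0 x1 (fun x => P x y0 - P x y1 + k * (y1 - y0)) +
  itg y0 y1 (fun y => Q x1 y - Q x0 y - k * (x1 - x0))); last first.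
  have cA : ctson x0 x1 (fun x => P x y0 - P x y1) by exact: ctsonB.
  have cB : ctson y0 y1 (fun y => Q x1 y - Q x0 y) by exact: ctsonB.
  rewrite (itgD cA (@ctson_cst _ _ _ _)) (itgB cB (@ctson_cst _ _ _ _)).
  by rewrite itgB// itgB// itg_cst// itg_cst//; ring.
apply: (le_trans (ler_normD _ _)).
rewrite (_ : e * _ = e * l * (x1 - x0) + e * l * (y1 - y0)); last by rewrite /l; ring.
apply: lerD; apply: itg_norm_le => //.
- by apply: ctsonD; [exact: ctsonB|exact: ctson_cst].
- move=> x xx.
  rewrite [X in `|X|](_ : _ = (P x y0 - P s t - (p * (x - s) + k * (y0 - t))) -
    (P x y1 - P s t - (p * (x - s) + k * (y1 - t)))); last by ring.
  apply: (le_trans (ler_normB _ _)).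
  have := EP x y0 xx; rewrite lexx y01 => /(_ isT) A1.
  have := EP x y1 xx; rewrite lexx y01 => /(_ isT) A2.
  lra.
- by apply: ctsonB; [exact: ctsonB|exact: ctson_cst].
move=> y yy.
rewrite [X in `|X|](_ : _ = (Q x1 y - Q s t - (k * (x1 - s) + q * (y - t))) -
  (Q x0 y - Q s t - (k * (x0 - s) + q * (y - t)))); last by ring.
apply: (le_trans (ler_normB _ _)).
have := EQ x0 y; rewrite lexx x01 => /(_ isT yy) A1.
have := EQ x1 y; rewrite lexx x01 => /(_ isT yy) A2.
lra.
Qed.

End goursat.

(** * Trigonometric polynomials and Bessel's inequality *)

Section fourier.
Variable R : realType.
Implicit Types f g : R -> R.
Local Notation mu := (@lebesgue_measure R).

Lemma itg_FTC a b f (F : R -> R) : a < b -> continuous f ->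
  (forall x : R, is_derive x 1 F (f x)) -> itg a b f = F b - F a.
Proof.
move=> ab cf dF; rewrite /itg /Rintegral (@continuous_FTC2 _ f F)//.
- by apply: ctson_within; exact: ctsonT.
- have cF : continuous F by move=> x; exact: is_derive_continuous (dF x).
  split=> [x _||]; first exact: (@ex_derive _ _ _ _ _ _ _ (dF x)).
  + by apply: cvg_at_right_filter; exact: cF.
  + by apply: cvg_at_left_filter; exact: cF.
- by move=> x _; rewrite derive1E; apply: derive_val.
Qed.

Lemma sin_nat2pi n : sin (n%:R * (2 * pi)) = 0 :> R.
Proof.
have := periodicn (@sinD2pi R) n 0; rewrite add0r sin0 => H; rewrite -[RHS]H; congr sin.
by rewrite !mulr_natl.
Qed.

Lemma cos_nat2pi n : cos (n%:R * (2 * pi)) = 1 :> R.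
Proof.
have := periodicn (@cosD2pi R) n 0; rewrite add0r cos0 => H; rewrite -[RHS]H; congr cos.
by rewrite !mulr_natl.
Qed.

Lemma continuous_cosM (x : R) : continuous (fun t => cos (x * t)).
Proof.
move=> t; apply: (@continuous_comp _ _ _ (fun t => x * t) cos).
  by apply: cvgM; [exact: cvg_cst|exact: cvg_id].
exact: continuous_cos.
Qed.

Lemma continuous_sinM (x : R) : continuous (fun t => sin (x * t)).
Proof.
move=> t; apply: (@continuous_comp _ _ _ (fun t => x * t) sin).
  by apply: cvgM; [exact: cvg_cst|exact: cvg_id].
exact: continuous_sin.
Qed.

Lemma is_deriveMc (c x l : R) f : is_derive x 1 f l ->
  is_derive x 1 (fun t => c * f t) (c * l).
Proof. exact: (@is_deriveZ R R R f c x 1 l). Qed.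

Lemma is_derive_mulcst (c x : R) : is_derive x 1 (fun t => c * t) c.
Proof.
have H : is_derive x 1 (fun t : R => c * id t) (c * 1) by exact: is_deriveMc.
by rewrite -[X in is_derive _ _ _ X]mulr1.
Qed.

Lemma itg_cosM (x : R) : x != 0 ->
  itg 0 (2 * pi) (fun t => cos (x * t)) = sin (x * (2 * pi)) / x.
Proof.
move=> x0; have p0 : 0 < 2 * pi :> R by rewrite mulr_gt0// pi_gt0.
have dF (t : R) : is_derive t 1 (fun t => x^-1 * sin (x * t)) (cos (x * t)).
  have H := is_derive1_comp (is_derive_sin (x * t)) (is_derive_mulcst x t).
  rewrite (_ : cos _ = x^-1 * (cos (x * t) * x)); last by field.
  exact: is_deriveMc.
rewrite (itg_FTC p0 (@continuous_cosM x) dF).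
by rewrite mulr0 sin0 mulr0 subr0 mulrC.
Qed.

Lemma itg_sinM (x : R) : x != 0 ->
  itg 0 (2 * pi) (fun t => sin (x * t)) = (1 - cos (x * (2 * pi))) / x.
Proof.
move=> x0; have p0 : 0 < 2 * pi :> R by rewrite mulr_gt0// pi_gt0.
have dF (t : R) : is_derive t 1 (fun t => - x^-1 * cos (x * t)) (sin (x * t)).
  have H := is_derive1_comp (is_derive_cos (x * t)) (is_derive_mulcst x t).
  rewrite (_ : sin _ = - x^-1 * (- sin (x * t) * x)); last by field.
  exact: is_deriveMc.
rewrite (itg_FTC p0 (@continuous_sinM x) dF).
by rewrite mulr0 cos0; field.
Qed.

Definition cosn n (t : R) : R := cos (n%:R * t).
Definition sinn n (t : R) : R := sin (n%:R * t).
Definition circle_itg f : R := itg 0 (2 * pi) f.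

Lemma pi2_ge0 : 0 <= 2 * pi :> R.
Proof. by rewrite mulr_ge0// pi_ge0. Qed.

Lemma ctson_tc a b n : ctson a b (cosn n).
Proof. by apply: ctsonT; exact: continuous_cosM. Qed.

Lemma ctson_ts a b n : ctson a b (sinn n).
Proof. by apply: ctsonT; exact: continuous_sinM. Qed.

Let freqD n m (x := n%:R + m%:R : R) :
  sin (x * (2 * pi)) = 0 /\ cos (x * (2 * pi)) = 1.
Proof. by rewrite /x -natrD sin_nat2pi cos_nat2pi. Qed.

Let freqB n m (x := n%:R - m%:R : R) :
  sin (x * (2 * pi)) = 0 /\ cos (x * (2 * pi)) = 1.
Proof.
rewrite /x mulrBl sinB cosB !sin_nat2pi !cos_nat2pi.
by rewrite !mul0r !mul1r subr0 addr0.
Qed.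

Let J_cosD n m : (0 < n)%N -> circle_itg (fun t => cos ((n%:R + m%:R) * t)) = 0.
Proof.
move=> n0; rewrite /circle_itg itg_cosM; first by rewrite (freqD n m).1 mul0r.
by rewrite -natrD pnatr_eq0 addn_eq0 negb_and -lt0n n0.
Qed.

Let J_sinD n m : (0 < n)%N -> circle_itg (fun t => sin ((n%:R + m%:R) * t)) = 0.
Proof.
move=> n0; rewrite /circle_itg itg_sinM; first by rewrite (freqD n m).2 subrr mul0r.
by rewrite -natrD pnatr_eq0 addn_eq0 negb_and -lt0n n0.
Qed.

Let J_cosB n m : circle_itg (fun t => cos ((n%:R - m%:R) * t)) = if n == m then 2 * pi else 0.
Proof.
have [->|nm] := eqVneq n m.
  rewrite /circle_itg (@eq_itg _ _ _ _ (fun=> 1)) ?itg_cst ?pi2_ge0//.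
    by rewrite mul1r subr0.
  by move=> x _; rewrite subrr mul0r cos0.
rewrite /circle_itg itg_cosM; first by rewrite (freqB n m).1 mul0r.
by rewrite subr_eq0 eqr_nat.
Qed.

Let J_sinB n m : circle_itg (fun t => sin ((n%:R - m%:R) * t)) = 0.
Proof.
have [->|nm] := eqVneq n m.
  rewrite /circle_itg (@eq_itg _ _ _ _ (fun=> 0)) ?itg_cst ?pi2_ge0//.
    by rewrite mul0r.
  by move=> x _; rewrite subrr mul0r sin0.
rewrite /circle_itg itg_sinM; first by rewrite (freqB n m).2 subrr mul0r.
by rewrite subr_eq0 eqr_nat.
Qed.

Lemma J_tctc n m : (0 < n)%N -> circle_itg (fun t => cosn n t * cosn m t) = if n == m then pi else 0.
Proof.
move=> n0; have cM (x : R) : ctson 0 (2 * pi) (fun t => cos (x * t)).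
  by apply: ctsonT; exact: continuous_cosM.
rewrite (_ : circle_itg _ = circle_itg (fun t => 2^-1 *
    (cos ((n%:R - m%:R) * t) + cos ((n%:R + m%:R) * t)))); last first.
  apply: eq_itg => t _; rewrite /cosn mulrBl mulrDl cosB cosD; by field.
rewrite /circle_itg itgZ ?itgD//; last exact: ctsonD.
rewrite -/(circle_itg _) J_cosB -/(circle_itg _) J_cosD// addr0.
by case: ifP => _; rewrite ?mulr0 // mulKf.
Qed.

Lemma J_tsts n m : (0 < n)%N -> circle_itg (fun t => sinn n t * sinn m t) = if n == m then pi else 0.
Proof.
move=> n0; have cM (x : R) : ctson 0 (2 * pi) (fun t => cos (x * t)).
  by apply: ctsonT; exact: continuous_cosM.
rewrite (_ : circle_itg _ = circle_itg (fun t => 2^-1 *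
    (cos ((n%:R - m%:R) * t) - cos ((n%:R + m%:R) * t)))); last first.
  apply: eq_itg => t _; rewrite /sinn mulrBl mulrDl cosB cosD; by field.
rewrite /circle_itg itgZ ?itgB//; last exact: ctsonB.
rewrite -/(circle_itg _) J_cosB -/(circle_itg _) J_cosD// subr0.
by case: ifP => _; rewrite ?mulr0 // mulKf.
Qed.

Lemma J_tcts n m : (0 < m)%N -> circle_itg (fun t => cosn n t * sinn m t) = 0.
Proof.
move=> m0; have cM (x : R) : ctson 0 (2 * pi) (fun t => sin (x * t)).
  by apply: ctsonT; exact: continuous_sinM.
rewrite (_ : circle_itg _ = circle_itg (fun t => 2^-1 *
    (sin ((m%:R - n%:R) * t) + sin ((m%:R + n%:R) * t)))); last first.
  apply: eq_itg => t _; rewrite /cosn /sinn mulrBl mulrDl sinB sinD; by field.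
rewrite /circle_itg itgZ ?itgD//; last exact: ctsonD.
by rewrite -/(circle_itg _) J_sinB -/(circle_itg _) J_sinD// addr0 mulr0.
Qed.

(** Index [i] stands for frequency i + 1, here and in [fcos] and [fsin]. The constant term is kept
    apart, since only the oscillating part depends on s in the application. *)
Definition trigpoly (x y : nat -> R) N t : R :=
  \sum_(i < N) (x i * cosn i.+1 t + y i * sinn i.+1 t).

Lemma ctson_trigpoly a b x y N : ctson a b (trigpoly x y N).
Proof.
apply: (@ctson_sum _ _ _ _ (fun i t => x i * cosn i.+1 t + y i * sinn i.+1 t)) => i.
by apply: ctsonD; apply: ctsonM; try exact: ctson_cst;
  [exact: ctson_tc|exact: ctson_ts].
Qed.

Lemma J_mul_trigpoly f x y N : ctson 0 (2 * pi) f ->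
  circle_itg (fun t => f t * trigpoly x y N t) =
  \sum_(i < N) (x i * circle_itg (fun t => f t * cosn i.+1 t) +
                y i * circle_itg (fun t => f t * sinn i.+1 t)).
Proof.
move=> cf.
have cc i : ctson 0 (2 * pi) (fun t => f t * cosn i t).
  by apply: ctsonM => //; exact: ctson_tc.
have cs i : ctson 0 (2 * pi) (fun t => f t * sinn i t).
  by apply: ctsonM => //; exact: ctson_ts.
have cZ (c : R) g : ctson 0 (2 * pi) g -> ctson 0 (2 * pi) (fun t => c * g t).
  by move=> cg; apply: ctsonM => //; exact: ctson_cst.
pose F i t := x i * (f t * cosn i.+1 t) + y i * (f t * sinn i.+1 t).
rewrite (_ : circle_itg _ = circle_itg (fun t => \sum_(i < N) F i t)); last first.
  apply: eq_itg => t _; rewrite /trigpoly mulr_sumr.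
  by apply: eq_bigr => i _; rewrite /F; ring.
rewrite /circle_itg (@itg_sum _ _ _ _ F) ?pi2_ge0//; last first.
  by move=> i; apply: ctsonD; exact: cZ.
by apply: eq_bigr => i _; rewrite itgD ?itgZ//; exact: cZ.
Qed.

Lemma J_sqr_trigpoly x y N :
  circle_itg (fun t => trigpoly x y N t ^+ 2) = pi * \sum_(i < N) (x i ^+ 2 + y i ^+ 2).
Proof.
rewrite (_ : circle_itg _ = circle_itg (fun t => trigpoly x y N t * trigpoly x y N t)); last first.
  by apply: eq_itg => t _; rewrite expr2.
rewrite J_mul_trigpoly; last exact: ctson_trigpoly.
rewrite mulr_sumr; apply: eq_bigr => m _.
have -> : circle_itg (fun t => trigpoly x y N t * cosn m.+1 t) = pi * x m.
  rewrite (_ : circle_itg _ = circle_itg (fun t => cosn m.+1 t * trigpoly x y N t)); last first.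
    by apply: eq_itg => t _; rewrite mulrC.
  rewrite J_mul_trigpoly; last exact: ctson_tc.
  rewrite (bigD1 m)//= J_tctc// J_tcts// eqxx mulr0 addr0 big1 ?addr0 1?mulrC//.
  move=> i im; rewrite J_tctc// J_tcts// mulr0 addr0 eqSS eq_sym.
  by rewrite (negbTE (im : val i != val m)) mulr0.
have -> : circle_itg (fun t => trigpoly x y N t * sinn m.+1 t) = pi * y m.
  rewrite (_ : circle_itg _ = circle_itg (fun t => sinn m.+1 t * trigpoly x y N t)); last first.
    by apply: eq_itg => t _; rewrite mulrC.
  have sc i : circle_itg (fun t => sinn m.+1 t * cosn i.+1 t) = 0.
    rewrite -(@J_tcts i.+1 m.+1)//; apply: eq_itg => t _; exact: mulrC.
  rewrite J_mul_trigpoly; last exact: ctson_ts.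
  rewrite (bigD1 m)//= J_tsts// sc eqxx mulr0 add0r big1 ?addr0 1?mulrC//.
  move=> i im; rewrite J_tsts// sc mulr0 add0r eqSS eq_sym.
  by rewrite (negbTE (im : val i != val m)) mulr0.
ring.
Qed.

Definition fcos f i : R := circle_itg (fun t => f t * cosn i.+1 t) / pi.
Definition fsin f i : R := circle_itg (fun t => f t * sinn i.+1 t) / pi.

(** Integrate (f - T)^2 >= 0 for the partial Fourier sum [T]: by orthogonality the integrals of f T
    and of T^2 agree. *)
Lemma bessel f N : ctson 0 (2 * pi) f ->
  pi * \sum_(i < N) (fcos f i ^+ 2 + fsin f i ^+ 2) <= circle_itg (fun t => f t ^+ 2).
Proof.
move=> cf; set T := trigpoly (fcos f) (fsin f) N.
have cT : ctson 0 (2 * pi) T by exact: ctson_trigpoly.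
have pi0 : pi != 0 :> R by rewrite gt_eqF// pi_gt0.
have JfT : circle_itg (fun t => f t * T t) = pi * \sum_(i < N) (fcos f i ^+ 2 + fsin f i ^+ 2).
  rewrite J_mul_trigpoly// mulr_sumr; apply: eq_bigr => i _.
  have -> : circle_itg (fun t => f t * cosn i.+1 t) = pi * fcos f i by rewrite mulrC divfK.
  have -> : circle_itg (fun t => f t * sinn i.+1 t) = pi * fsin f i by rewrite mulrC divfK.
  by ring.
have : 0 <= circle_itg (fun t => f t ^+ 2 - (2 * (f t * T t) - T t ^+ 2)).
  apply: itg_ge0 => t _; have := sqr_ge0 (f t - T t); rewrite sqrrB; lra.
have c2 : ctson 0 (2 * pi) (fun t => f t ^+ 2) by exact: ctsonM.
have c3 : ctson 0 (2 * pi) (fun t => T t ^+ 2) by exact: ctsonM.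
have c4 : ctson 0 (2 * pi) (fun t => f t * T t) by exact: ctsonM.
have c5 : ctson 0 (2 * pi) (fun t => 2 * (f t * T t)).
  by apply: ctsonM => //; exact: ctson_cst.
rewrite /circle_itg itgB//; last exact: ctsonB.
rewrite itgB// itgZ// -!/(circle_itg _) JfT J_sqr_trigpoly; lra.
Qed.

(** Bessel bounds the partial sums of the squared coefficients, so that series converges and its
    terms tend to 0. *)
Lemma riemann_lebesgue f : ctson 0 (2 * pi) f ->
  (fcos f @ \oo --> 0) /\ (fsin f @ \oo --> 0).
Proof.
move=> cf; pose u i := fcos f i ^+ 2 + fsin f i ^+ 2.
have u0 i : 0 <= u i by rewrite addr_ge0// sqr_ge0.
have cu : u @ \oo --> 0.
  apply: cvg_series_cvg_0; apply: nondecreasing_is_cvgn.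
    apply/nondecreasing_seqP => n; rewrite -subr_ge0.
    by rewrite seriesSr addrAC subrr add0r.
  exists (circle_itg (fun t => f t ^+ 2) / pi) => _ [n _ <-].
  by rewrite ler_pdivlMr ?pi_gt0// mulrC seriesEord; exact: bessel.
have sq (w : nat -> R) : (forall i, w i ^+ 2 <= u i) -> w @ \oo --> 0.
  move=> wu; apply/cvgrPdist_le => e e0.
  have /cvgrPdist_le/(_ _ (exprn_gt0 2 e0)) := cu.
  apply: filterS => i; rewrite !sub0r !normrN (ger0_norm (u0 i)) => ui.
  by rewrite -(ler_sqr (normr_ge0 _) (ltW e0)) real_normK ?num_real// (le_trans (wu i)).
by split; apply: sq => i; rewrite ?lerDl ?lerDr sqr_ge0.
Qed.

End fourier.

(** * Pointwise convergence of Fourier series *)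

Section fourier_convergence.
Variable R : realType.
Implicit Types f g : R -> R.
Local Notation mu := (@lebesgue_measure R).

(** Only the approximants are assumed continuous: in the main use the limit is built from the
    s-derivatives of log p, whose continuity is never established. *)
Lemma fatou_itg a b (F_ : nat -> R -> R) (F : R -> R) K :
  (forall N, ctson a b (F_ N)) ->
  (forall N t, a <= t <= b -> 0 <= F_ N t) ->
  (forall t, a <= t <= b -> F_ N t @[N --> \oo] --> F t) ->
  (forall N, itg a b (F_ N) <= K) -> itg a b F <= K.
Proof.
move=> cF F0 FF FK.
have K0 : 0 <= K by apply: le_trans (FK 0%N); apply: itg_ge0 => t; exact: F0.
have H : (\int[mu]_(t in `[a, b]) (F t)%:E <= K%:E)%E.
  apply: (@le_trans _ _ (\int[mu]_(t in `[a, b]) limn_einf (fun N => (F_ N t)%:E))%E).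
    rewrite le_eqVlt; apply/orP; left; apply/eqP; apply: eq_integral => t.
    rewrite inE/= in_itv/= => tab.
    have /cvg_limn_einf_sup[-> _]// : (F_ N t)%:E @[N --> \oo] --> (F t)%:E.
    by apply: cvg_EFin; [exact: nearW|exact: FF].
  apply: (@le_trans _ _ (limn_einf (fun N => \int[mu]_(t in `[a, b]) (F_ N t)%:E)))%E.
    apply: (@fatou _ _ _ mu `[a, b]%classic _ (fun N t => (F_ N t)%:E)) => //.
    by move=> N; apply: (measurable_int mu); exact: ctson_integrable.
  rewrite limn_einf_lim; apply: lime_le.
    exact: is_cvg_einfs.
  apply: nearW => n; apply: (@le_trans _ _ (\int[mu]_(t in `[a, b]) (F_ n t)%:E)%E).
    by apply: ereal_inf_lbound; exists n => //=.
  rewrite -(@fineK _ (\int[mu]_(t in `[a, b]) (F_ n t)%:E)%E) ?lee_fin; first exact: FK.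
  by apply: integrable_fin_num => //; exact: ctson_integrable.
rewrite /itg /Rintegral -lee_fin; apply: le_trans H.
(* [fine] sends both infinities to 0, so the real integral is below the extended one unless the
   latter is -oo, which nonnegativity of the limit excludes. *)
case E : (\int[mu]_(t in `[a, b]) (F t)%:E)%E => [r| |] //=.
  by rewrite leey.
have : (0 <= \int[mu]_(t in `[a, b]) (F t)%:E)%E.
  apply: integral_ge0 => t/=; rewrite in_itv/= => tab; rewrite lee_fin.
  rewrite -(cvg_lim _ (FF t tab))//; apply: limr_ge.
    by apply/cvg_ex; exists (F t); exact: FF.
  by apply: nearW => N; exact: F0.
by rewrite E.
Qed.

Lemma slope_cvg f (x l : R) : is_derive x 1 f l ->
  (f t - f x) / (t - x) @[t --> x^'] --> l.
Proof.
move=> fl; apply/cvgrPdist_le => e e0; have [d d0 H] := is_derive_lin fl e0.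
exists d => //= t tx tNx; have {}tx : `|t - x| < d by rewrite distrC.
have h0 : t - x != 0 by rewrite subr_eq0.
rewrite -(ler_pM2r (_ : 0 < `|t - x|)) ?normr_gt0// -normrM.
rewrite [X in `|X|](_ : _ = - (f t - f x - l * (t - x))); last by field.
by rewrite normrN; exact: H.
Qed.

(** L'Hopital's rule at a simple zero of [g]: divide both functions by t - x. The second conclusion
    ensures that the quotient is a genuine one near [x], not the default value of a division by
    0. *)
Lemma ratio_cvg f g (x l m : R) : is_derive x 1 f l -> is_derive x 1 g m ->
  m != 0 -> f x = 0 -> g x = 0 ->
  (f t / g t @[t --> x^'] --> l / m) /\ (\forall t \near x^', g t != 0).
Proof.
move=> fl gm m0 fx gx.
have Hf := slope_cvg fl; have Hg := slope_cvg gm.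
have nx : \forall t \near x^', t != x by exact: nbhs_dnbhs_neq.
split.
  have H : (f t - f x) / (t - x) * ((g t - g x) / (t - x))^-1 @[t --> x^'] --> l / m.
    by apply: cvgM => //; exact: cvgV.
  apply: cvg_trans H; apply: near_eq_cvg; near=> t.
  have tx : t != x by near: t.
  rewrite fx gx !subr0 invfM invrK mulrACA mulVf ?mulr1//.
  by rewrite subr_eq0.
have : \forall t \near x^', (g t - g x) / (t - x) != 0 by exact: cvgr_neq0 Hg m0.
by apply: filterS => t; apply: contra_neq => ->; rewrite gx subrr mul0r.
Unshelve. all: by end_near.
Qed.

Lemma sin_nat_half0 N (u : R) : sin (u / 2) = 0 -> sin (N%:R * u) = 0.
Proof.
move=> s0; have su : sin u = 0.
  by rewrite (_ : u = (u / 2) *+ 2) ?sin_mulr2n ?s0 ?mulr0 ?mul0rn// -mulr_natr divfK.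
elim: N => [|N IH]; first by rewrite mul0r sin0.
by rewrite -natr1 mulrDl mul1r sinD IH su mul0r mulr0 addr0.
Qed.

(** The Dirichlet kernel sin ((N + 1/2) u) / sin (u / 2), with mean value 1 over the circle. *)
Definition dirichlet N (u : R) : R := 1 + 2 * \sum_(i < N) cos (i.+1%:R * u).

(** The closed form of the kernel without denominator, with sin ((N + 1/2) u) expanded so that only
    the integer frequency [N] occurs: Riemann-Lebesgue then applies as stated. *)
Lemma dirichletE N u : dirichlet N u * sin (u / 2) =
  cos (u / 2) * sin (N%:R * u) + cos (N%:R * u) * sin (u / 2).
Proof.
rewrite /dirichlet; elim: N => [|N IH].
  by rewrite big_ord0 !mul0r sin0 cos0; ring.
rewrite big_ord_recr/= mulrDr addrA mulrDl IH.
have -> : N.+1%:R * u = N%:R * u + u / 2 + u / 2 by rewrite -natr1; field.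
set a := N%:R * u; set b := u / 2.
have E : sin b * cos (a + b + b) - cos b * sin (a + b + b) =
    - (sin a * cos b + cos a * sin b).
  by rewrite -sinB -sinD -sinN; congr sin; ring.
lra.
Qed.

(* The sine factor of [(f t - f t0) * dirichlet N (t - t0)] has a removable
   singularity: this is its continuous extension. *)
Definition dirichlet_quot f (t0 t : R) : R :=
  if sin ((t - t0) / 2) == 0 then 2 * derive1 f t
  else (f t - f t0) * cos ((t - t0) / 2) / sin ((t - t0) / 2).

Definition periodic2pi f := forall t, f (t + 2 * pi) = f t.

(** The half-angle sine vanishes only at multiples of 2 pi: after removal of [n] whole periods the
    remainder [u] lies in [0, 2 pi), where sin (u / 2) = 0 forces u = 0. *)
Lemma periodic2pi_sin_half0 f (t0 t : R) : periodic2pi f ->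
  sin ((t - t0) / 2) = 0 -> f t = f t0.
Proof.
move=> fp; wlog tt0 : t t0 / t0 <= t => [H s0|].
  have [|tt0] := leP t0 t; first by move=> /H; apply.
  apply/esym; apply: H; first exact: ltW.
  by rewrite (_ : _ / 2 = - ((t - t0) / 2)) ?sinN ?s0 ?oppr0//; field.
have fn n x : f (x + n%:R * (2 * pi)) = f x.
  elim: n => [|n IH]; first by rewrite mul0r addr0.
  by rewrite -natr1 mulrDl mul1r addrA fp.
have p0 : 0 < 2 * pi :> R by rewrite mulr_gt0// pi_gt0.
pose n := Num.truncn ((t - t0) / (2 * pi)).
have /andP[n1 n2] : n%:R <= (t - t0) / (2 * pi) < n.+1%:R.
  by apply: truncn_itv; rewrite divr_ge0 ?subr_ge0// ltW.
rewrite ler_pdivlMr// in n1; rewrite ltr_pdivrMr// -natr1 in n2.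
pose u := t - t0 - n%:R * (2 * pi).
have u0 : 0 <= u by rewrite subr_ge0.
have u2 : u < 2 * pi by rewrite /u; lra.
have eu : sin (u / 2) = 0 -> u = 0.
  move=> su; apply/eqP; move: u0; rewrite le_eqVlt => /orP[/eqP->//|u0].
  suff : 0 < sin (u / 2) by rewrite su ltxx.
  by apply: sin_gt0_pi; rewrite divr_gt0//= ltr_pdivrMr// mulrC.
have sB k (x : R) : sin x = 0 -> sin (x - k%:R * pi) = 0.
  elim: k x => [|k IH] x sx; first by rewrite mul0r subr0.
  rewrite -natr1 mulrDl mul1r opprD addrA sinB IH// sinpi cospi.
  by rewrite mul0r mulr0 subrr.
move=> /(sB n).
rewrite (_ : _ - _ = u / 2); last by rewrite /u; field.
move=> /eu; rewrite /u => /eqP; rewrite subr_eq0 subr_eq => /eqP ->.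
by rewrite addrC fn.
Qed.

Lemma dirichlet_quotE f (t0 t : R) N : periodic2pi f ->
  (f t - f t0) * dirichlet N (t - t0) =
  dirichlet_quot f t0 t * sin (N%:R * (t - t0)) +
  (f t - f t0) * cos (N%:R * (t - t0)).
Proof.
move=> fp; rewrite /dirichlet_quot; case: ifPn => [/eqP s0|s0].
  by rewrite (periodic2pi_sin_half0 fp s0) subrr !mul0r sin_nat_half0// mulr0 addr0.
apply: (mulIf s0); rewrite -(mulrA _ (dirichlet _ _)) dirichletE; field.
by rewrite s0.
Qed.

Lemma is_derive_half (t0 t : R) :
  is_derive t 1 (fun t => sin ((t - t0) / 2)) (cos ((t - t0) / 2) / 2).
Proof.
have H : is_derive t 1 (fun t => (t - t0) / 2) (2^-1 : R).
  have := @fdiff_derive1 R (fun x _ => (x - t0) * 2^-1) t 0 2^-1 0; apply.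
  have := fdiffM (fdiffB (fdiff_fst t 0) (fdiff_cst t0 t 0)) (fdiff_cst 2^-1 t 0).
  by rewrite !mulr0 !subr0 !addr0 mul1r mul0r.
exact: (is_derive1_comp (is_derive_sin _) H).
Qed.

(** At a zero of the half-angle sine the numerator vanishes too, by periodicity, and
    differentiability of [f] at that point gives the limit f' / (cos / 2) * cos = 2 f', the value
    built into the definition. *)
Lemma continuous_dirichlet_quot f (t0 : R) : (forall t, derivable f t 1) ->
  periodic2pi f -> continuous (dirichlet_quot f t0).
Proof.
move=> df fp t1; have cf : continuous f.
  by move=> t; apply: differentiable_continuous; apply/derivable1_diffP.
have chalf : continuous (fun t => (t - t0) / 2).
  by move=> t; apply: cvgM (cvg_cst _); apply: cvgB; [exact: cvg_id|exact: cvg_cst].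
have csin : continuous (fun t => sin ((t - t0) / 2)).
  by move=> t; exact: is_derive_continuous (is_derive_half t0 t).
have ccos : continuous (fun t => cos ((t - t0) / 2)).
  by move=> t; apply: continuous_comp; [exact: chalf|exact: continuous_cos].
have [s0|s0] := eqVneq (sin ((t1 - t0) / 2)) 0; last first.
  have H : (f t - f t0) * cos ((t - t0) / 2) / sin ((t - t0) / 2) @[t --> t1] -->
      dirichlet_quot f t0 t1.
    rewrite /dirichlet_quot (negbTE s0); apply: cvgM.
      by apply: cvgM; [apply: cvgB; [exact: cf|exact: cvg_cst]|exact: ccos].
    by apply: cvgV => //; exact: csin.
  apply: cvg_trans H; apply: near_eq_cvg.
  have : \forall t \near t1, sin ((t - t0) / 2) != 0 by exact: cvgr_neq0 (csin t1) s0.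
  apply: filterS => t st.
  by rewrite /dirichlet_quot (negbTE st).
apply/continuous_withinNx.
have c0 : cos ((t1 - t0) / 2) / 2 != 0.
  rewrite mulf_neq0 ?invr_neq0//; apply/eqP => c0.
  by have := cos2Dsin2 ((t1 - t0) / 2); rewrite s0 c0 expr0n addr0 => /eqP; rewrite eq_sym oner_eq0.
have hf : is_derive t1 1 (fun t => f t - f t0) (derive1 f t1).
  have -> : derive1 f t1 = derive1 f t1 - 0 by rewrite subr0.
  apply: (@is_deriveB _ _ _ f (cst (f t0)) t1 1).
  by rewrite derive1E; apply: DeriveDef.
have f10 : f t1 - f t0 = 0 by rewrite (periodic2pi_sin_half0 fp s0) subrr.
have [Hr Hn] := ratio_cvg hf (is_derive_half t0 t1) c0 f10 s0.
have H : (f t - f t0) / sin ((t - t0) / 2) * cos ((t - t0) / 2) @[t --> t1^'] -->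
    dirichlet_quot f t0 t1.
  rewrite /dirichlet_quot s0 eqxx.
  rewrite (_ : 2 * _ = derive1 f t1 / (cos ((t1 - t0) / 2) / 2) * cos ((t1 - t0) / 2)).
    apply: cvgM; first exact: Hr.
    by apply: cvg_trans (ccos t1); apply: cvg_app; exact: cvg_within.
  by field; apply: contra_neq c0 => ->; rewrite mul0r.
apply: cvg_trans H; apply: near_eq_cvg.
apply: filterS Hn => t st.
by rewrite /dirichlet_quot (negbTE st) mulrAC.
Qed.


Definition fourier_sum f N t : R := circle_itg f / (2 * pi) + trigpoly (fcos f) (fsin f) N t.

Let pi0 : pi != 0 :> R. Proof. by rewrite gt_eqF// pi_gt0. Qed.

Lemma fourier_sumE f N (t0 : R) : ctson 0 (2 * pi) f ->
  fourier_sum f N t0 = circle_itg (fun t => f t * dirichlet N (t - t0)) / (2 * pi).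
Proof.
move=> cf; pose x i : R := cosn i.+1 t0; pose y i : R := sinn i.+1 t0.
have E : circle_itg (fun t => f t * dirichlet N (t - t0)) =
    circle_itg f + 2 * circle_itg (fun t => f t * trigpoly x y N t).
  have c1 : ctson 0 (2 * pi) (fun t => f t * trigpoly x y N t).
    by apply: ctsonM => //; exact: ctson_trigpoly.
  rewrite /circle_itg -itgZ// -itgD//; last by apply: ctsonM => //; exact: ctson_cst.
  apply: eq_itg => t _; rewrite /dirichlet mulrDr mulr1 (mulrCA (f t)) /=; congr (_ + 2 * (_ * _)).
  by apply: eq_bigr => i _; rewrite mulrBr cosB mulrC [sin _ * _]mulrC.
rewrite E J_mul_trigpoly// /fourier_sum (mulrDl (circle_itg f)); congr (_ + _).
rewrite mulr_sumr mulr_suml; apply: eq_bigr => i _.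
by rewrite /fcos /fsin /x /y; move: pi0; generalize (@pi R) => P P0; field.
Qed.

(** Read off from the constant function 1, which equals each of its Fourier sums. *)
Lemma J_dirichlet N (t0 : R) : circle_itg (fun t => dirichlet N (t - t0)) = 2 * pi.
Proof.
have c1 : ctson 0 (2 * pi) (fun=> 1 : R) by exact: ctson_cst.
have := fourier_sumE N t0 c1.
rewrite (_ : circle_itg (fun t => 1 * _) = circle_itg (fun t => dirichlet N (t - t0))); last first.
  by apply: eq_itg => t _; rewrite mul1r.
rewrite /fourier_sum /trigpoly big1 => [|i _]; last first.
  have f0 : i.+1%:R != 0 :> R by rewrite pnatr_eq0.
  rewrite /fcos /fsin (_ : circle_itg _ = 0).
    rewrite (_ : circle_itg _ = 0); first by rewrite !mul0r addr0.
    rewrite /circle_itg (@eq_itg _ _ _ _ (sinn i.+1)); last by move=> t _; rewrite mul1r.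
    by rewrite itg_sinM// cos_nat2pi subrr mul0r.
  rewrite /circle_itg (@eq_itg _ _ _ _ (cosn i.+1)); last by move=> t _; rewrite mul1r.
  by rewrite itg_cosM// sin_nat2pi mul0r.
rewrite addr0 => /divIf <-; last by rewrite mulf_neq0.
by rewrite /circle_itg itg_cst ?pi2_ge0// mul1r subr0.
Qed.

Lemma fourier_sum_cvg f (t0 : R) : (forall t, derivable f t 1) -> periodic2pi f ->
  fourier_sum f N t0 @[N --> \oo] --> f t0.
Proof.
move=> df fp; have cf : ctson 0 (2 * pi) f.
  apply: ctsonT => t; apply: differentiable_continuous; exact/derivable1_diffP.
pose G := dirichlet_quot f t0; pose h t := f t - f t0.
have cG : ctson 0 (2 * pi) G by apply: ctsonT; exact: continuous_dirichlet_quot.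
have ch : ctson 0 (2 * pi) h by apply: ctsonB => //; exact: ctson_cst.
have cd N : ctson 0 (2 * pi) (fun t => dirichlet N (t - t0)).
  pose x i : R := 2 * cosn i.+1 t0; pose y i : R := 2 * sinn i.+1 t0.
  rewrite (_ : (fun t => _) = (fun t => 1 + trigpoly x y N t)).
    by apply: ctsonD; [exact: ctson_cst|exact: ctson_trigpoly].
  apply/funext => t; rewrite /dirichlet mulr_sumr; congr (_ + _).
  by apply: eq_bigr => i _; rewrite mulrBr cosB /x /y /cosn /sinn; ring.
(* The error of the Fourier sum is the mean of (f t - f t0) times the kernel, which splits into
   Fourier coefficients of [G] and [h]. Index [N] of a coefficient is frequency N + 1, hence the
   shift; 2^-1 compares division by 2 pi with division by pi. *)
have E N : fourier_sum f N.+1 t0 = f t0 + 2^-1 *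
    ((fsin G N * cosn N.+1 t0 - fcos G N * sinn N.+1 t0) +
     (fcos h N * cosn N.+1 t0 + fsin h N * sinn N.+1 t0)).
  have cM g k : ctson 0 (2 * pi) g -> ctson 0 (2 * pi) (fun t => g t * k t) ->
    forall c : R, ctson 0 (2 * pi) (fun t => g t * k t * c).
    by move=> cg cgk c; apply: ctsonM => //; exact: ctson_cst.
  have c1 : ctson 0 (2 * pi) (fun t => G t * cosn N.+1 t) by apply: ctsonM => //; exact: ctson_tc.
  have c2 : ctson 0 (2 * pi) (fun t => G t * sinn N.+1 t) by apply: ctsonM => //; exact: ctson_ts.
  have c3 : ctson 0 (2 * pi) (fun t => h t * cosn N.+1 t) by apply: ctsonM => //; exact: ctson_tc.
  have c4 : ctson 0 (2 * pi) (fun t => h t * sinn N.+1 t) by apply: ctsonM => //; exact: ctson_ts.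
  have cZ (c : R) g : ctson 0 (2 * pi) g -> ctson 0 (2 * pi) (fun t => c * g t).
    by move=> cg; apply: ctsonM => //; exact: ctson_cst.
  rewrite fourier_sumE// (_ : circle_itg _ = f t0 * (2 * pi) +
     circle_itg (fun t => (cosn N.+1 t0 * (G t * sinn N.+1 t) - sinn N.+1 t0 * (G t * cosn N.+1 t)) +
        (cosn N.+1 t0 * (h t * cosn N.+1 t) + sinn N.+1 t0 * (h t * sinn N.+1 t)))).
    rewrite /circle_itg itgD; [|by apply: ctsonB; exact: cZ|by apply: ctsonD; exact: cZ].
    rewrite itgB ?itgD ?itgZ//; do ?exact: cZ.
    by rewrite /fcos /fsin /circle_itg; move: pi0; generalize (@pi R) => P P0; field.
  rewrite -(J_dirichlet N.+1 t0) -itgZ// -itgD//; [|exact: cZ|].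
    apply: eq_itg => t _.
    have := dirichlet_quotE t0 t N.+1 fp; rewrite -/G -/(h t) mulrBr sinB cosB.
    rewrite -/(cosn N.+1 t) -/(sinn N.+1 t) -/(cosn N.+1 t0) -/(sinn N.+1 t0) => H.
    rewrite (_ : f t = f t0 + h t); last by rewrite /h addrC subrK.
    by rewrite mulrDl H; ring.
  by apply: ctsonD; [apply: ctsonB|apply: ctsonD]; exact: cZ.
suff H : f t0 + 2^-1 * ((fsin G N * cosn N.+1 t0 - fcos G N * sinn N.+1 t0) +
    (fcos h N * cosn N.+1 t0 + fsin h N * sinn N.+1 t0)) @[N --> \oo] --> f t0.
  rewrite -cvg_shiftS; apply: cvg_trans H; apply: near_eq_cvg.
  by apply: nearW => N /=; rewrite E.
rewrite -[X in _ --> X]addr0 -(mulr0 2^-1); apply: cvgD; first exact: cvg_cst.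
apply: cvgM; first exact: cvg_cst.
have [G1 G2] := riemann_lebesgue cG; have [h1 h2] := riemann_lebesgue ch.
have bd (u w : nat -> R) : u @ \oo --> 0 -> (forall n, `|w n| <= 1) ->
    u n * w n @[n --> \oo] --> 0.
  move=> u0 w1; apply/cvgrPdist_le => e e0.
  have /cvgrPdist_le/(_ e e0) := u0; apply: filterS => n.
  rewrite !sub0r !normrN normrM => ue; apply: le_trans ue.
  by rewrite ler_piMr.
have ct n : `|cosn n.+1 t0| <= 1 by exact: cos_max.
have st n : `|sinn n.+1 t0| <= 1 by exact: sin_max.
rewrite -[X in _ --> X]addr0; apply: cvgD.
  by rewrite -[X in _ --> X]subr0; apply: cvgB; exact: bd.
by rewrite -[X in _ --> X]addr0; apply: cvgD; exact: bd.
Qed.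

(** The converse of Bessel's inequality: the squared partial sums have integral at most [K] and
    converge pointwise, so Fatou applies. The mean must vanish because [K] accounts only for
    positive frequencies. *)
Lemma parseval_le f K : (forall t, derivable f t 1) -> periodic2pi f -> circle_itg f = 0 ->
  (forall N, pi * \sum_(i < N) (fcos f i ^+ 2 + fsin f i ^+ 2) <= K) ->
  circle_itg (fun t => f t ^+ 2) <= K.
Proof.
move=> df fp Jf0 HK.
apply: (@fatou_itg _ _ (fun N t => trigpoly (fcos f) (fsin f) N t ^+ 2)).
- by move=> N; apply: ctsonM; exact: ctson_trigpoly.
- by move=> N t _; exact: sqr_ge0.
- move=> t _; have H := fourier_sum_cvg (t0 := t) df fp.
  rewrite expr2; under eq_fun do rewrite expr2.
  have {}H : trigpoly (fcos f) (fsin f) N t @[N --> \oo] --> f t.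
    by move: H; rewrite /fourier_sum Jf0 mul0r; under eq_fun do rewrite add0r.
  exact: cvgM.
by move=> N; rewrite -/(circle_itg _) J_sqr_trigpoly.
Qed.

End fourier_convergence.

(** * Conjugate harmonic pairs on a half-plane *)

Section strip.
Variable R : realType.
Implicit Types U V P Q : R -> R -> R.

(** U + i V is complex differentiable in s + i t on the left half-plane, which exp maps onto the
    punctured unit disc. *)
Definition cauchy_riemann U V := forall s t : R, s < 0 ->
  exists a b, fdiff U s t a b /\ fdiff V s t (- b) a.

(** Multiplication of U + i V by -i; it transfers facts about first components to second
    components. *)
Lemma cauchy_riemann_swap U V : cauchy_riemann U V ->
  cauchy_riemann V (fun s t => - U s t).
Proof.
move=> UV s t s0; have [a [b [hU hV]]] := UV s t s0.
by exists (- b), a; split => //; exact: fdiffN.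
Qed.

Lemma cauchy_riemannM U V P Q : cauchy_riemann U V -> cauchy_riemann P Q ->
  cauchy_riemann (fun s t => U s t * P s t - V s t * Q s t)
                 (fun s t => U s t * Q s t + V s t * P s t).
Proof.
move=> UV PQ s t s0; have [a [b [hU hV]]] := UV s t s0.
have [c [d [hP hQ]]] := PQ s t s0.
have h1 := fdiffB (fdiffM hU hP) (fdiffM hV hQ).
have h2 := fdiffD (fdiffM hU hQ) (fdiffM hV hP).
exists (a * P s t + U s t * c - (- b * Q s t + V s t * (- d))).
exists (b * P s t + U s t * d - (a * Q s t + V s t * c)); split => //.
move: h2; congr fdiff; ring.
Qed.

Lemma cauchy_riemann_exp (c : R) :
  cauchy_riemann (fun s t => expR (c * s) * cos (c * t))
                 (fun s t => expR (c * s) * sin (c * t)).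
Proof.
move=> s t _.
have hs : fdiff (fun x _ => c * x) s t c 0.
  have := fdiffM (fdiff_cst c s t) (fdiff_fst s t).
  by congr fdiff; ring.
have ht : fdiff (fun _ y => c * y) s t 0 c.
  have := fdiffM (fdiff_cst c s t) (fdiff_snd s t).
  by congr fdiff; ring.
have he := @fdiff_fun1 R expR (fun x _ => c * x) s t _ _ _ (is_derive_expR (c * s)) hs.
have hc := @fdiff_fun1 R cos (fun _ y => c * y) s t _ _ _ (is_derive_cos (c * t)) ht.
have hn := @fdiff_fun1 R sin (fun _ y => c * y) s t _ _ _ (is_derive_sin (c * t)) ht.
exists (c * (expR (c * s) * cos (c * t))), (- c * (expR (c * s) * sin (c * t))).
split; first by move: (fdiffM he hc); congr fdiff; ring.
by move: (fdiffM he hn); congr fdiff; ring.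
Qed.

Lemma cauchy_riemann_cts U V : cauchy_riemann U V -> forall s, s < 0 ->
  continuous (U s).
Proof.
move=> UV s s0 t; have [a [b [hU _]]] := UV s t s0.
exact: is_derive_continuous (fdiff_derive2 hU).
Qed.

(** Goursat for the closed form V ds + U dt on [s, s'] x [0, 2 pi]: the horizontal sides cancel
    because V has equal values at 0 and 2 pi, and the vertical sides are the two means. *)
Lemma mean_constant U V : cauchy_riemann U V ->
  (forall s, s < 0 -> V s (2 * pi) = V s 0) ->
  forall s s', s < 0 -> s' < 0 -> circle_itg (U s) = circle_itg (U s').
Proof.
move=> UV Vp; suff H s s' : s <= s' -> s' < 0 -> circle_itg (U s) = circle_itg (U s').
  move=> s s' s0 s'0; have [|/ltW] := leP s s' => ss'; first exact: H.
  by apply/esym/H.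
move=> ss' s'0.
have PQ (x t : R) : s <= x <= s' -> 0 <= t <= 2 * pi ->
    exists p k q, fdiff V x t p k /\ fdiff U x t k q.
  move=> /andP[_ xs'] _; have [a [b [hU hV]]] := UV x t (le_lt_trans xs' s'0).
  by exists (- b), a, b.
have := goursat ss' (pi2_ge0 R) PQ; rewrite /boundary_itg.
rewrite (_ : itg s s' (V^~ 0) = itg s s' (V^~ (2 * pi))); last first.
  by apply: eq_itg => x /andP[_ xs']; rewrite /= Vp// (le_lt_trans xs').
by rewrite subrr add0r => /eqP; rewrite subr_eq0 => /eqP/esym.
Qed.

(** * Fourier coefficients of a conjugate pair bounded near s = -oo *)

Section conjugate_pair.
Variables (L v : R -> R -> R) (M S0 : R).
Hypothesis Lv : cauchy_riemann L v.
Hypothesis Lp : forall s : R, s < 0 -> periodic2pi (L s).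
Hypothesis vp : forall s : R, s < 0 -> periodic2pi (v s).
Hypothesis S00 : S0 < 0.
Hypothesis bounded : forall s t, s <= S0 -> `|L s t| <= M /\ `|v s t| <= M.

Let cL (s : R) : s < 0 -> ctson 0 (2 * pi) (L s).
Proof. by move=> s0; apply: ctsonT; exact: cauchy_riemann_cts Lv _ s0. Qed.

Let cv (s : R) : s < 0 -> ctson 0 (2 * pi) (v s).
Proof.
by move=> s0; apply: ctsonT; exact: cauchy_riemann_cts (cauchy_riemann_swap Lv) _ s0.
Qed.

Let Jc (U : R -> R) n := circle_itg (fun t => U t * cosn n t).
Let Js (U : R -> R) n := circle_itg (fun t => U t * sinn n t).

Let cMc (U : R -> R) n : ctson 0 (2 * pi) U -> ctson 0 (2 * pi) (fun t => U t * cosn n t).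
Proof. by move=> cU; apply: ctsonM => //; exact: ctson_tc. Qed.

Let cMs (U : R -> R) n : ctson 0 (2 * pi) U -> ctson 0 (2 * pi) (fun t => U t * sinn n t).
Proof. by move=> cU; apply: ctsonM => //; exact: ctson_ts. Qed.

Let edge (U : R -> R) : periodic2pi U -> U (2 * pi) = U 0.
Proof. by move=> Up; rewrite -[X in U X]add0r Up. Qed.

Let expand (c s : R) : s < 0 ->
  circle_itg (fun t => L s t * (expR (c * s) * cos (c * t)) - v s t * (expR (c * s) * sin (c * t)))
  = expR (c * s) * (circle_itg (fun t => L s t * cos (c * t)) - circle_itg (fun t => v s t * sin (c * t))).
Proof.
move=> s0.
have c1 : ctson 0 (2 * pi) (fun t => L s t * cos (c * t)).
  by apply: ctsonM; [exact: cL|apply: ctsonT; exact: continuous_cosM].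
have c2 : ctson 0 (2 * pi) (fun t => v s t * sin (c * t)).
  by apply: ctsonM; [exact: cv|apply: ctsonT; exact: continuous_sinM].
rewrite /circle_itg -itgB// -itgZ//; last exact: ctsonB.
by apply: eq_itg => t _; ring.
Qed.

Let expand' (c s : R) : s < 0 ->
  circle_itg (fun t => L s t * (expR (c * s) * sin (c * t)) + v s t * (expR (c * s) * cos (c * t)))
  = expR (c * s) * (circle_itg (fun t => L s t * sin (c * t)) + circle_itg (fun t => v s t * cos (c * t))).
Proof.
move=> s0.
have c1 : ctson 0 (2 * pi) (fun t => L s t * sin (c * t)).
  by apply: ctsonM; [exact: cL|apply: ctsonT; exact: continuous_sinM].
have c2 : ctson 0 (2 * pi) (fun t => v s t * cos (c * t)).
  by apply: ctsonM; [exact: cv|apply: ctsonT; exact: continuous_cosM].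
rewrite /circle_itg -itgD// -itgZ//; last exact: ctsonD.
by apply: eq_itg => t _; ring.
Qed.

(** The mean of (L + i v) e^(c (s + i t)), real and imaginary parts separately. The two conditions
    make [c] an integer, which keeps the product periodic; both signs of [c] are used below. *)
Let exp_pair_constant (c : R) : cos (c * (2 * pi)) = 1 -> sin (c * (2 * pi)) = 0 ->
  forall s s', s < 0 -> s' < 0 ->
  expR (c * s) * (circle_itg (fun t => L s t * cos (c * t)) - circle_itg (fun t => v s t * sin (c * t))) =
  expR (c * s') * (circle_itg (fun t => L s' t * cos (c * t)) - circle_itg (fun t => v s' t * sin (c * t)))
  /\
  expR (c * s) * (circle_itg (fun t => L s t * sin (c * t)) + circle_itg (fun t => v s t * cos (c * t))) =
  expR (c * s') * (circle_itg (fun t => L s' t * sin (c * t)) + circle_itg (fun t => v s' t * cos (c * t))).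
Proof.
move=> c1 c0 s s' s0 s'0; have H := cauchy_riemannM Lv (cauchy_riemann_exp c).
have H' := cauchy_riemann_swap H.
split.
  have := mean_constant H _ s0 s'0; rewrite !expand//; apply => x x0.
  by rewrite c1 c0 !mulr0 cos0 sin0 ?(edge (Lp x0)) ?(edge (vp x0)) ?mulr0.
have := mean_constant H' _ s0 s'0; rewrite !expand'//; apply => x x0.
by rewrite c1 c0 !mulr0 cos0 sin0 ?(edge (Lp x0)) ?(edge (vp x0)) ?mulr0.
Qed.

Let J_bound (U : R -> R) (K : R) : ctson 0 (2 * pi) U -> (forall t, `|U t| <= K) -> `|circle_itg U| <= K * (2 * pi).
Proof.
move=> cU UK; rewrite -[X in K * X]subr0; apply: itg_norm_le => //.
exact: pi2_ge0.
Qed.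

(* This kills the Fourier coefficients of negative index: the moments of log p
   against [exp (n (s + i t))] do not depend on s and tend to 0 at -oo. *)
Let zero_of_decay (n : nat) (F : R -> R) (K : R) : (0 < n)%N ->
  (forall s s', s < 0 -> s' < 0 -> expR (n%:R * s) * F s = expR (n%:R * s') * F s') ->
  (forall s, s <= S0 -> `|F s| <= K) -> forall s, s < 0 -> F s = 0.
Proof.
move=> n0 HF FK s s0; apply/eqP; apply/negP => /negP Fs.
pose e := expR (n%:R * s) * `|F s|.
have e0 : 0 < e by rewrite mulr_gt0 ?expR_gt0 ?normr_gt0.
have K0 : 0 <= K by apply: le_trans (FK S0 _).
have K1 : 0 < K + 1 by lra.
(* Far enough to the left for e^(n s') (K + 1) < e: the choice gives K + 1 <= - s' e, and e^(s') (-
   s') < 1 because 1 + x < e^x for nonzero x. *)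
pose s' := Num.min S0 (- (K + 1) / e).
have s'S : s' <= S0 by rewrite ge_min lexx.
have s'0 : s' < 0 by exact: le_lt_trans S00.
have : e = expR (n%:R * s') * `|F s'|.
  by rewrite /e -(gtr0_norm (expR_gt0 (n%:R * s))) -normrM (HF s s')// normrM
     (gtr0_norm (expR_gt0 _)).
suff : expR (n%:R * s') * `|F s'| < e by move=> + E; rewrite -E ltxx.
have se : s' <= - (K + 1) / e by rewrite ge_min lexx orbT.
rewrite ler_pdivlMr// in se.
have es : expR (n%:R * s') * (- s') < 1.
  apply: (@le_lt_trans _ _ (expR s' * (- s'))).
    apply: ler_wpM2r; first by rewrite oppr_ge0 ltW.
    have n1 : 1 <= n%:R :> R by rewrite ler1n.
    by rewrite ler_expR; have := ler_wnM2r (ltW s'0) n1; rewrite mul1r.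
  have := expR_gt1Dx (_ : - s' != 0); rewrite oppr_eq0 lt_eqF// => /(_ isT).
  rewrite expRN -(ltr_pM2l (expR_gt0 s')) mulfV ?gt_eqF ?expR_gt0//.
  have := expR_gt0 s'; lra.
apply: (@le_lt_trans _ _ (expR (n%:R * s') * (K + 1))).
  by rewrite ler_pM2l ?expR_gt0// (le_trans (FK _ s'S))// lerDl.
apply: (@le_lt_trans _ _ (expR (n%:R * s') * (- s') * e)).
  by rewrite -mulrA ler_pM2l ?expR_gt0//; lra.
by rewrite gtr_pMl.
Qed.

(** Real and imaginary parts of the vanishing moment of L + i v against e^(i n t). They express the
    coefficients of L through those of v, so the bound on v alone will control both. *)
Let coefs n s : (0 < n)%N -> s < 0 ->
  Jc (L s) n = Js (v s) n /\ Js (L s) n = - Jc (v s) n.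
Proof.
move=> n0 s0.
have HC := exp_pair_constant (cos_nat2pi R n) (sin_nat2pi R n).
have cS x : x <= S0 -> x < 0 by move=> /le_lt_trans; apply.
have tcb t : `|cosn n t| <= 1 :> R by exact: cos_max.
have tsb t : `|sinn n t| <= 1 :> R by exact: sin_max.
have M0 : 0 <= M by have [+ _] := bounded 0 (lexx S0); apply: le_trans.
have bnd (U : R -> R) w : (forall t, `|U t| <= M) -> (forall t, `|w t| <= 1) ->
    forall t, `|U t * w t| <= M.
  by move=> HU Hw t; rewrite normrM -[X in _ <= X]mulr1; apply: ler_pM.
have Z1 := @zero_of_decay n (fun s => Jc (L s) n - Js (v s) n)
  (M * (2 * pi) + M * (2 * pi)) n0.
have Z2 := @zero_of_decay n (fun s => Js (L s) n + Jc (v s) n)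
  (M * (2 * pi) + M * (2 * pi)) n0.
split.
  apply/eqP; rewrite -subr_eq0; apply/eqP; apply: Z1 => // [x y x0 y0|x xS].
    exact: (HC x y x0 y0).1.
  apply: (le_trans (ler_normB _ _)); apply: lerD; apply: J_bound.
  - by apply: cMc; apply: cL; exact: cS.
  - by apply: bnd => // t; exact: (bounded t xS).1.
  - by apply: cMs; apply: cv; exact: cS.
  - by apply: bnd => // t; exact: (bounded t xS).2.
apply/eqP; rewrite -subr_eq0 opprK; apply/eqP; apply: Z2 => // [x y x0 y0|x xS].
  exact: (HC x y x0 y0).2.
apply: (le_trans (ler_normD _ _)); apply: lerD; apply: J_bound.
- by apply: cMs; apply: cL; exact: cS.
- by apply: bnd => // t; exact: (bounded t xS).1.
- by apply: cMc; apply: cv; exact: cS.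
- by apply: bnd => // t; exact: (bounded t xS).2.
Qed.

(** The moments against e^(-n (s + i t)) do not depend on s; by [coefs] their two parts are twice a
    coefficient of v times e^(-n s). *)
Let growth n s s' : (0 < n)%N -> s < 0 -> s' < 0 ->
  Jc (v s) n = expR (n%:R * (s - s')) * Jc (v s') n /\
  Js (v s) n = expR (n%:R * (s - s')) * Js (v s') n.
Proof.
move=> n0 s0 s'0.
have c1 : cos (- n%:R * (2 * pi)) = 1 :> R by rewrite mulNr cosN cos_nat2pi.
have c0 : sin (- n%:R * (2 * pi)) = 0 :> R by rewrite mulNr sinN sin_nat2pi oppr0.
have HC := exp_pair_constant c1 c0.
have E1 (U : R -> R) : circle_itg (fun t => U t * cos (- n%:R * t)) = Jc U n.
  by apply: eq_itg => t _; rewrite mulNr cosN.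
have E2 (U : R -> R) : ctson 0 (2 * pi) U -> circle_itg (fun t => U t * sin (- n%:R * t)) = - Js U n.
  move=> cU; rewrite /Js /circle_itg -itgN; last exact: cMs.
  by apply: eq_itg => t _; rewrite mulNr sinN mulrN.
have [H1 H2] := HC s s' s0 s'0.
rewrite !E1 !E2 in H1 H2; try exact: cL; try exact: cv.
have [a1 a2] := coefs n0 s0; have [b1 b2] := coefs n0 s'0.
rewrite a1 b1 in H1; rewrite a2 b2 in H2.
have e0 := expR_gt0 (- n%:R * s).
have ee : expR (- n%:R * s') = expR (n%:R * (s - s')) * expR (- n%:R * s).
  by rewrite -expRD; congr expR; ring.
rewrite ee in H1 H2; split; apply: (mulfI (lt0r_neq0 e0)); lra.
Qed.

(** The coefficients of v extrapolated to the unit circle s = 0, where nothing is known about v: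
    they are read at s = -1 and rescaled. *)
Definition xcoef i := expR (i.+1%:R) * fcos (v (-1)) i.
Definition ycoef i := expR (i.+1%:R) * fsin (v (-1)) i.

Lemma pair_coefs i s : s < 0 ->
  [/\ fcos (v s) i = expR (i.+1%:R * s) * xcoef i,
      fsin (v s) i = expR (i.+1%:R * s) * ycoef i,
      fcos (L s) i = expR (i.+1%:R * s) * ycoef i &
      fsin (L s) i = - (expR (i.+1%:R * s) * xcoef i)].
Proof.
move=> s0; have m0 : -1 < 0 :> R by rewrite ltrN10.
have [g1 g2] := growth (ltn0Sn i) s0 m0; have [a1 a2] := coefs (ltn0Sn i) s0.
have E : expR (i.+1%:R * (s - -1)) = expR (i.+1%:R * s) * expR (i.+1%:R).
  by rewrite -expRD; congr expR; ring.
rewrite E in g1 g2.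
have F1 : fcos (v s) i = expR (i.+1%:R * s) * xcoef i.
  by rewrite /fcos -/(Jc (v s) i.+1) g1 /xcoef /fcos -/(Jc (v _) i.+1); ring.
have F2 : fsin (v s) i = expR (i.+1%:R * s) * ycoef i.
  by rewrite /fsin -/(Js (v s) i.+1) g2 /ycoef /fsin -/(Js (v _) i.+1); ring.
split => //; first by rewrite -F2 /fcos -/(Jc (L s) i.+1) a1.
by rewrite -F1 /fsin -/(Js (L s) i.+1) a2 mulNr.
Qed.

End conjugate_pair.

End strip.

(** * Energy of conjugate pairs *)

Section energy.
Variable R : realType.
Implicit Types f g : R -> R.

Lemma fcos_diffquot f g (h : R) i : ctson 0 (2 * pi) f -> ctson 0 (2 * pi) g ->
  fcos (fun t => h * (f t - g t)) i = h * (fcos f i - fcos g i).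
Proof.
move=> cf cg; rewrite /fcos -mulrBl mulrA; congr (_ / _).
have c1 : ctson 0 (2 * pi) (fun t => f t * cosn i.+1 t).
  by apply: ctsonM => //; exact: ctson_tc.
have c2 : ctson 0 (2 * pi) (fun t => g t * cosn i.+1 t).
  by apply: ctsonM => //; exact: ctson_tc.
rewrite /circle_itg -itgB// -itgZ//; last exact: ctsonB.
by apply: eq_itg => t _; ring.
Qed.

Lemma fsin_diffquot f g (h : R) i : ctson 0 (2 * pi) f -> ctson 0 (2 * pi) g ->
  fsin (fun t => h * (f t - g t)) i = h * (fsin f i - fsin g i).
Proof.
move=> cf cg; rewrite /fsin -mulrBl mulrA; congr (_ / _).
have c1 : ctson 0 (2 * pi) (fun t => f t * sinn i.+1 t).
  by apply: ctsonM => //; exact: ctson_ts.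
have c2 : ctson 0 (2 * pi) (fun t => g t * sinn i.+1 t).
  by apply: ctsonM => //; exact: ctson_ts.
rewrite /circle_itg -itgB// -itgZ//; last exact: ctsonB.
by apply: eq_itg => t _; ring.
Qed.

(** Difference quotients with steps to the left only, which never leave the half-plane s < 0. *)
Lemma slope_seq_cvg f (s l : R) : is_derive s 1 f l ->
  (- k.+1%:R) * (f (s - k.+1%:R^-1) - f s) @[k --> \oo] --> l.
Proof.
move=> fl; apply/cvgrPdist_le => e e0; have [d d0 H] := is_derive_lin fl e0.
near=> k; have k0 : k.+1%:R != 0 :> R by rewrite pnatr_eq0.
have kp : 0 < k.+1%:R :> R by rewrite ltr0n.
have kd : k.+1%:R^-1 < d by near: k; exact: (near_infty_natSinv_lt (PosNum d0)).
have := H (s - k.+1%:R^-1); rewrite addrAC subrr add0r normrN gtr0_norm ?invr_gt0//.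
move=> /(_ kd); rewrite ler_pdivlMr// => {}H; apply: le_trans H.
rewrite [X in `|X| <= _](_ : _ =
  (f (s - k.+1%:R^-1) - f s - l * - k.+1%:R^-1) * k.+1%:R); last by field.
by rewrite normrM (gtr0_norm kp).
Unshelve. all: by end_near.
Qed.

(** * Energy of difference quotients in s *)

Section harmonic.
Variables (u : R -> R -> R) (x y : nat -> R) (A : R).
Hypothesis du : forall s t : R, s < 0 -> derivable (u s) t 1.
Hypothesis up : forall s : R, s < 0 -> periodic2pi (u s).
Hypothesis uA : forall s : R, s < 0 -> circle_itg (u s) = A.
Hypothesis ux : forall i (s : R), s < 0 -> fcos (u s) i = expR (i.+1%:R * s) * x i.
Hypothesis uy : forall i (s : R), s < 0 -> fsin (u s) i = expR (i.+1%:R * s) * y i.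

Lemma harmonic_ctson (s : R) : s < 0 -> ctson 0 (2 * pi) (u s).
Proof.
move=> s0; apply: ctsonT => t; apply: differentiable_continuous.
by apply/derivable1_diffP; exact: du.
Qed.

(** The quotient has the coefficients of [u s] multiplied by (e^(n h) - 1) / h, which lies between 0
    and n since h < 0. Its energy is thus bounded by that of the formal s-derivative, uniformly in
    h. *)
Lemma diffquot_energy (s h K : R) : s < 0 -> h < 0 ->
  (forall N, pi * \sum_(i < N) (i.+1%:R * expR (i.+1%:R * s)) ^+ 2 *
     (x i ^+ 2 + y i ^+ 2) <= K) ->
  circle_itg (fun t => (h^-1 * (u (s + h) t - u s t)) ^+ 2) <= K.
Proof.
move=> s0 h0 HK; have sh0 : s + h < 0 by lra.
have c1 := harmonic_ctson s0; have c2 := harmonic_ctson sh0.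
apply: (@parseval_le _ (fun t => h^-1 * (u (s + h) t - u s t))).
- move=> t; apply: derivableM; first exact: derivable_cst.
  by apply: derivableB; exact: du.
- by move=> t; rewrite !up.
- by rewrite /circle_itg itgZ ?itgB -?/(circle_itg _) ?uA ?subrr ?mulr0//; exact: ctsonB.
move=> N; apply: le_trans (HK N); rewrite ler_pM2l ?pi_gt0//.
apply: ler_sum => i _; rewrite fcos_diffquot// fsin_diffquot// !ux// !uy//.
rewrite (mulrDr i.+1%:R s h) expRD; set n := i.+1%:R; set e := expR (n * s).
have e0 : 0 < e by exact: expR_gt0.
have n0 : 0 < n by rewrite ltr0n.
set q := h^-1 * (expR (n * h) - 1).
have q0 : 0 <= q.
  by rewrite /q -mulrNN mulr_ge0 ?oppr_ge0 ?invr_le0 ?(ltW h0)// subr_le0 expR_le1 pmulr_rle0// ltW.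
have qn : q <= n.
  rewrite /q -(ler_nM2l h0) mulrA mulfV ?lt_eqF// mul1r.
  by have := expR_ge1Dx (n * h); lra.
rewrite (_ : _ + _ = (q * e) ^+ 2 * (x i ^+ 2 + y i ^+ 2)); last by rewrite /q; ring.
apply: ler_wpM2r; first by rewrite addr_ge0// sqr_ge0.
have a0 : 0 <= q * e by rewrite mulr_ge0// ltW.
have b0 : 0 <= n * e by rewrite mulr_ge0// ltW.
by rewrite ler_sqr ?nnegrE// ler_pM2r.
Qed.

End harmonic.

(** [c i] is |a_n|^2 for n = i + 1. The infinite Parseval sum is replaced by an arbitrary upper
    bound [K] of its partial sums. *)
Lemma strip_energy (L v L1 v1 : R -> R -> R) (M S0 : R) :
  cauchy_riemann L v ->
  (forall s : R, s < 0 -> periodic2pi (L s)) ->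
  (forall s : R, s < 0 -> periodic2pi (v s)) ->
  S0 < 0 -> (forall s t : R, s <= S0 -> `|L s t| <= M /\ `|v s t| <= M) ->
  (forall s t : R, s < 0 -> `|v s t| <= pi / 2) ->
  (forall s t : R, s < 0 -> is_derive s 1 (v^~ t) (v1 s t)) ->
  (forall s t : R, s < 0 -> is_derive s 1 (L^~ t) (L1 s t)) ->
  exists c : nat -> R, [/\ forall i, 0 <= c i,
    forall N, \sum_(i < N) c i <= pi ^+ 2 / 2 &
    forall s K : R, s < 0 ->
      (forall N, 2 * pi * \sum_(i < N) (i.+1%:R * expR (i.+1%:R * s)) ^+ 2 * c i <= K) ->
      circle_itg (fun t => v1 s t ^+ 2 + L1 s t ^+ 2) <= K].
Proof.
move=> Lv Lp vp S00 bd vpi dv dL.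
pose x := xcoef v; pose y := ycoef v; pose c i := x i ^+ 2 + y i ^+ 2.
have c0 i : 0 <= c i by rewrite addr_ge0// sqr_ge0.
have vL := cauchy_riemann_swap Lv.
have Lt (s t : R) : s < 0 -> derivable (L s) t 1.
  move=> s0; have [a [b [h _]]] := Lv s t s0.
  exact: (@ex_derive _ _ _ _ _ _ _ (fdiff_derive2 h)).
have vt (s t : R) : s < 0 -> derivable (v s) t 1.
  move=> s0; have [a [b [h _]]] := vL s t s0.
  exact: (@ex_derive _ _ _ _ _ _ _ (fdiff_derive2 h)).
have m0 : -1 < 0 :> R by rewrite ltrN10.
have edge (U : R -> R) : periodic2pi U -> U (2 * pi) = U 0.
  by move=> Up; rewrite -[X in U X]add0r Up.
have JL (s : R) : s < 0 -> circle_itg (L s) = circle_itg (L (-1)).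
  by move=> s0; apply: (mean_constant Lv) => // z z0; exact/edge/vp.
have Jv (s : R) : s < 0 -> circle_itg (v s) = circle_itg (v (-1)).
  by move=> s0; apply: (mean_constant vL) => // z z0; rewrite (edge _ (Lp z z0)).
have co i (s : R) (s0 : s < 0) := pair_coefs Lv Lp vp S00 bd i s0.
have vc i (s : R) (s0 : s < 0) : fcos (v s) i = expR (i.+1%:R * s) * x i.
  by have [] := co i s s0.
have vs i (s : R) (s0 : s < 0) : fsin (v s) i = expR (i.+1%:R * s) * y i.
  by have [] := co i s s0.
have Lc i (s : R) (s0 : s < 0) : fcos (L s) i = expR (i.+1%:R * s) * y i.
  by have [] := co i s s0.
have Ls i (s : R) (s0 : s < 0) : fsin (L s) i = expR (i.+1%:R * s) * (- x i).
  by have [_ _ _ ->] := co i s s0; rewrite mulrN.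
exists c; split => // [N|s K s0 HK].
  set T := \sum_(i < N) c i.
  have T0 : 0 <= T by exact: sumr_ge0.
  (* Bessel is available only for s < 0, so s must tend to 0. For [N] terms e^(2 n s) >= 1 + 2 N s,
     and the [s] chosen below makes the loss 2 N |s| T at most [e]. *)
  apply/ler_addgt0Pr => e e0.
  have D0 : 0 < 2 * N%:R * T + 1 by rewrite ltr_wpDl// mulr_ge0// mulr_ge0.
  pose s := - (e / (2 * N%:R * T + 1)).
  have s0 : s < 0 by rewrite oppr_lt0 divr_gt0.
  have cvs := harmonic_ctson vt s0.
  have B1 := bessel N cvs.
  (* After division by the pi of Bessel's inequality this is the announced pi^2 / 2. *)
  have B2 : circle_itg (fun t => v s t ^+ 2) <= (pi / 2) ^+ 2 * (2 * pi).
    rewrite -[X in _ * X]subr0 -itg_cst ?pi2_ge0//.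
    apply: itg_le; [exact: ctsonM|exact: ctson_cst|move=> t _].
    by rewrite -[leLHS]real_normK ?num_real// ler_sqr ?nnegrE ?divr_ge0 ?pi_ge0//; exact: vpi.
  have B3 : (1 + 2 * N%:R * s) * T <= \sum_(i < N) (fcos (v s) i ^+ 2 + fsin (v s) i ^+ 2).
    rewrite /T mulr_sumr; apply: ler_sum => i _; rewrite vc// vs//.
    rewrite [leRHS](_ : _ = expR (i.+1%:R * s) ^+ 2 * c i); last by rewrite /c; ring.
    apply: ler_wpM2r => //; rewrite -expRM_natr.
    apply: le_trans (expR_ge1Dx _); rewrite lerD2l -mulrA [_ * 2]mulrC ler_pM2l//.
    by apply: ler_wnM2r; [exact: ltW|rewrite ler_nat].
  have : pi * ((1 + 2 * N%:R * s) * T) <= pi * (pi ^+ 2 / 2).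
    apply: (@le_trans _ _ (pi * \sum_(i < N) (fcos (v s) i ^+ 2 + fsin (v s) i ^+ 2))).
      by rewrite ler_pM2l ?pi_gt0.
    apply: (le_trans B1); apply: (le_trans B2).
    by rewrite le_eqVlt; apply/orP; left; apply/eqP; field.
  rewrite ler_pM2l ?pi_gt0// => B4.
  have : - (2 * N%:R * s * T) <= e.
    rewrite (_ : - _ = 2 * N%:R * T * e / (2 * N%:R * T + 1)); last first.
      by rewrite /s; field; rewrite gt_eqF.
    by rewrite ler_pdivrMr// mulrDr mulr1 mulrC lerDl ltW.
  by move: B4; rewrite mulrDl mul1r; lra.
pose h k : R := - k.+1%:R^-1.
have h0 k : h k < 0 by rewrite oppr_lt0 invr_gt0.
have sh k : s + h k < 0 by have := h0 k; lra.
pose D (u : R -> R -> R) k t := (h k)^-1 * (u (s + h k) t - u s t).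
have cD (u : R -> R -> R) k : (forall s t : R, s < 0 -> derivable (u s) t 1) -> ctson 0 (2 * pi) (D u k).
  move=> du; apply: ctsonM; first exact: ctson_cst.
  by apply: ctsonB; exact: harmonic_ctson.
apply: (@fatou_itg _ _ _ (fun k t => D v k t ^+ 2 + D L k t ^+ 2)).
- by move=> k; apply: ctsonD; apply: ctsonM; exact: cD.
- by move=> k t _; rewrite addr_ge0// sqr_ge0.
- move=> t _; have E (u : R -> R -> R) k :
    D u k t = - k.+1%:R * (u (s - k.+1%:R^-1) t - u s t).
    by rewrite /D /h invrN invrK.
  have Cv : D v k t @[k --> \oo] --> v1 s t.
    by under eq_fun do rewrite E; exact: slope_seq_cvg (dv s t s0).
  have CL : D L k t @[k --> \oo] --> L1 s t.
    by under eq_fun do rewrite E; exact: slope_seq_cvg (dL s t s0).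
  by apply: cvgD; apply: cvgM.
move=> k; rewrite itgD; [|by apply: ctsonM; exact: cD|by apply: ctsonM; exact: cD].
(* The coefficients of v and of L agree up to order and sign, so each function carries half of the
   energy. *)
have HK' (X Y : nat -> R) : (forall i, X i ^+ 2 + Y i ^+ 2 = c i) ->
    forall N, pi * \sum_(i < N) (i.+1%:R * expR (i.+1%:R * s)) ^+ 2 *
      (X i ^+ 2 + Y i ^+ 2) <= K / 2.
  move=> XY N; have := HK N; under [X in _ -> pi * X <= _]eq_bigr do rewrite XY.
  lra.
have Kv : circle_itg (fun t => D v k t ^+ 2) <= K / 2.
  by apply: (diffquot_energy vt vp Jv vc vs s0 (h0 k)); exact: HK'.
have KL : circle_itg (fun t => D L k t ^+ 2) <= K / 2.
  apply: (diffquot_energy Lt Lp JL Lc Ls s0 (h0 k)); apply: (HK' y (fun i => - x i)) => i.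
  by rewrite sqrrN addrC.
rewrite -/(circle_itg _) -/(circle_itg _); lra.
Qed.

End energy.

(** * Weighted sums *)

Section weighted_sums.
Variables (R : realType) (c : nat -> R) (B : R).
Hypothesis c0 : forall i, 0 <= c i.
Hypothesis cB : forall N, \sum_(i < N) c i <= B.

(** With y = n (1 - e^s), the inequality e^s >= 1 + s gives n s <= - y, and the maximum of y e^(-y)
    is 1 / e. *)
Lemma weight_le (s : R) n : s < 0 ->
  (1 - expR s) * (n%:R * expR (n%:R * s)) <= expR (-1).
Proof.
move=> s0; pose y := n%:R * (1 - expR s).
have sy : n%:R * s <= - y.
  rewrite /y -mulrN opprB ler_wpM2l// lerBrDr addrC; exact: expR_ge1Dx.
apply: (@le_trans _ _ (y * expR (- y))).
  rewrite mulrCA mulrA; apply: ler_wpM2l; last by rewrite ler_expR.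
  by rewrite mulr_ge0// subr_ge0 ltW// expR_lt1.
have := expR_ge1Dx (y - 1); rewrite addrC subrK => y1.
rewrite expRN ler_pdivrMr ?expR_gt0// -expRD addrC.
exact: y1.
Qed.

Lemma weighted_sum_le (s : R) N : s < 0 ->
  \sum_(i < N) (i.+1%:R * expR (i.+1%:R * s)) ^+ 2 * c i
    <= expR (-2) / (1 - expR s) ^+ 2 * B.
Proof.
move=> s0; have d0 : 0 < 1 - expR s by rewrite subr_gt0 expR_lt1.
apply: (@le_trans _ _ (expR (-2) / (1 - expR s) ^+ 2 * \sum_(i < N) c i)).
  rewrite mulr_sumr; apply: ler_sum => i _; apply: ler_wpM2r => //.
  rewrite ler_pdivlMr ?exprn_gt0// -exprMn.
  rewrite (_ : -2 = -1 + -1 :> R); last by ring.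
  rewrite expRD -expr2 ler_sqr ?nnegrE ?expR_ge0 ?mulr_ge0 ?expR_ge0 ?(ltW d0)//.
  by rewrite mulrC; exact: weight_le.
by apply: ler_wpM2l; rewrite ?divr_ge0 ?expR_ge0 ?sqr_ge0.
Qed.

(** [M] is chosen so that its partial sum is within [e] of the supremum of all partial sums. *)
Lemma tail_le (e : R) : 0 < e -> exists M, forall N,
  \sum_(i < N) (if (M <= i)%N then c i else 0) <= e.
Proof.
move=> e0; pose S N := \sum_(i < N) c i.
have hs : has_sup (range S).
  by split; [exists (S 0%N), 0%N|exists B => _ [N _ <-]; exact: cB].
have [_ [M _ <-] HM] := sup_adherent e0 hs; exists M => N.
have SM K : S K <= S M + e.
  have : S K <= sup (range S) by apply: ub_le_sup; [exact: hs.2|exists K].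
  by move: HM; lra.
have E K : \sum_(i < K) (if (M <= i)%N then c i else 0) = S K - S (minn K M).
  elim: K => [|K IH]; first by rewrite big_ord0 min0n subrr.
  rewrite big_ord_recr/= IH; case: (boolP (M <= K)%N) => [MK|]; last rewrite -ltnNge => KM.
    rewrite (minn_idPr MK) (minn_idPr (leqW MK)) /S (big_ord_recr K)/=; ring.
  by rewrite (minn_idPl (ltnW KM)) (minn_idPl KM) !subrr addr0.
rewrite E; have [NM|MN] := leqP N M; first by rewrite subrr ltW.
by rewrite lerBlDl SM.
Qed.

Lemma weighted_sum_small (e : R) : 0 < e -> exists2 d, 0 < d &
  forall s N, s < 0 -> 1 - expR s < d ->
  (1 - expR s) ^+ 2 * \sum_(i < N) (i.+1%:R * expR (i.+1%:R * s)) ^+ 2 * c i <= e.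
Proof.
move=> e0; have e20 : 0 < e / 2 by rewrite divr_gt0.
have [M HM] := tail_le e20.
have B0 : 0 <= B by apply: le_trans (cB 0); rewrite big_ord0.
have D0 : 0 < M%:R ^+ 2 * B + 1 by rewrite ltr_wpDl// mulr_ge0// sqr_ge0.
(* For i < M the weight is at most M, and d <= 1 gives d^2 <= d, so the head is at most d M^2 B <= e
   / 2. For i >= M the squared weight times d^2 is at most e^(-2) <= 1, and the tail remains. *)
exists (Num.min 1 (e / 2 / (M%:R ^+ 2 * B + 1))).
  by rewrite lt_min ltr01 divr_gt0.
move=> s N s0; rewrite lt_min => /andP[d1 d2].
have d0 : 0 < 1 - expR s by rewrite subr_gt0 expR_lt1.
set d := 1 - expR s in d0 d1 d2 *.
apply: (@le_trans _ _ (\sum_(i < N) (d * M%:R ^+ 2 * c i +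
    (if (M <= i)%N then c i else 0)))).
  rewrite mulr_sumr; apply: ler_sum => i _; rewrite mulrA -exprMn.
  have w0 : 0 <= d * (i.+1%:R * expR (i.+1%:R * s)).
    by rewrite mulr_ge0 ?mulr_ge0 ?expR_ge0 ?(ltW d0).
  case: ifPn => [Mi|]; last rewrite -ltnNge => iM.
    rewrite -[leLHS]add0r; apply: lerD.
      by rewrite !mulr_ge0 ?sqr_ge0 ?(ltW d0).
    rewrite -[leRHS]mul1r; apply: ler_wpM2r => //.
    apply: exprn_ile1 => //; apply: (le_trans (weight_le _ s0)).
    by rewrite expR_le1; lra.
  rewrite addr0; apply: ler_wpM2r => //; rewrite exprMn; apply: ler_pM.
  - exact: sqr_ge0.
  - exact: sqr_ge0.
  - by rewrite expr2 ler_piMr ?(ltW d0)// ltW.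
  - rewrite ler_sqr ?nnegrE ?mulr_ge0 ?expR_ge0//.
    rewrite -[leRHS]mulr1; apply: ler_pM; rewrite ?expR_ge0// ?ler_nat//.
    by rewrite expR_le1 pmulr_rle0 ?ltr0n// ltW.
rewrite big_split/= (splitr e); apply: lerD; last exact: HM.
apply: (@le_trans _ _ (d * M%:R ^+ 2 * B)).
  rewrite -mulr_sumr; apply: ler_wpM2l; last exact: cB.
  by apply: mulr_ge0; [exact: ltW|exact: sqr_ge0].
move: d2; rewrite ltr_pdivlMr// => d2.
by have := d0; lra.
Qed.

End weighted_sums.

(** * The logarithm in polar coordinates *)

Section log_polar.
Variables (R : realType) (p : CC R -> CC R).
Hypothesis hp : classP p.

Lemma normcE (z : CC R) : `|z| = (Normc.normc z)%:C%C :> CC R.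
Proof. by case: z. Qed.

Lemma sqr_normcE (z : CC R) :
  Normc.normc z ^+ 2 = complex.Re z ^+ 2 + complex.Im z ^+ 2.
Proof. by case: z => a b /=; rewrite sqr_sqrtr// addr_ge0// sqr_ge0. Qed.

Lemma normc_le_abs (a b : R) : Normc.normc (Complex a b) <= `|a| + `|b|.
Proof.
rewrite /= -(@ger0_norm _ (`|a| + `|b|)) ?addr_ge0// -sqrtr_sqr ler_wsqrtr//.
rewrite sqrrD !real_normK ?num_real// lerD2r lerDl.
by rewrite mulrn_wge0// mulr_ge0.
Qed.

Lemma absRe_le_normc (z : CC R) : `|complex.Re z| <= Normc.normc z.
Proof.
by case: z => a b /=; rewrite -sqrtr_sqr ler_wsqrtr// lerDl sqr_ge0.
Qed.

Lemma absIm_le_normc (z : CC R) : `|complex.Im z| <= Normc.normc z.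
Proof.
by case: z => a b /=; rewrite -sqrtr_sqr ler_wsqrtr// lerDr sqr_ge0.
Qed.

Lemma derivable_lin (z : CC R) : derivable p z 1 ->
  forall e : R, 0 < e -> exists2 d : R, 0 < d & forall w : CC R, Normc.normc w < d ->
    Normc.normc (p (w + z) - p z - derive1 p z * w) <= e * Normc.normc w.
Proof.
move=> pz e e0; have eC : 0 < (e%:C)%C :> CC R by rewrite ltcR.
have /cvgrPdist_le/(_ _ eC) := pz.
rewrite -/(derive p z 1) -derive1E => -[[d d'] /= d0 H].
(* The radius of a ball in [CC R] is itself complex; positivity forces its imaginary part to be
   0. *)
move: d0; rewrite ltcE/= => /andP[/eqP d'0 d0]; exists d => // w wd.
have [->|w0] := eqVneq w 0.
  by rewrite add0r subrr mulr0 subrr Normc.normc0 mulr0.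
have wd' : `|w| < Complex d d' :> CC R by rewrite d'0 normcE ltcR.
have := H w; rewrite /ball_/= sub0r normrN => /(_ wd' w0).
rewrite /GRing.scale/= mulr1 normcE lecR => {}H.
have -> : p (w + z) - p z - derive1 p z * w =
    - ((derive1 p z - w^-1 * (p (w + z) - p z)) * w) by field.
rewrite normcN Normc.normcM; apply: ler_wpM2r H.
by case: (w) => w1 w2; exact: sqrtr_ge0.
Qed.

Let F (x y : R) : R := complex.Re (p (Complex x y)).
Let G (x y : R) : R := complex.Im (p (Complex x y)).
Let a (x y : R) : R := complex.Re (derive1 p (Complex x y)).
Let b (x y : R) : R := complex.Im (derive1 p (Complex x y)).

Lemma in_disc (x y : R) : x ^+ 2 + y ^+ 2 < 1 -> `|Complex x y : CC R| < 1.
Proof.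
move=> xy; rewrite normcE ltcR /= -(sqrtr1 R) ltr_sqrt//.
Qed.

(** The Cauchy-Riemann equations: the differential of p is multiplication by p' = a + i b, whose
    real and imaginary parts are read off. *)
Let cartesian (x y : R) : x ^+ 2 + y ^+ 2 < 1 ->
  fdiff F x y (a x y) (- b x y) /\ fdiff G x y (b x y) (a x y).
Proof.
move=> xy; have pz := hp.1 _ (in_disc xy); set z : CC R := Complex x y in pz *.
have key (e : R) : 0 < e -> exists2 d : R, 0 < d &
    forall x' y', `|x' - x| < d -> `|y' - y| < d ->
    Normc.normc (p (Complex x' y') - p z - derive1 p z * Complex (x' - x) (y' - y))
      <= e * (`|x' - x| + `|y' - y|).
  move=> e0; have [d d0 H] := derivable_lin pz e0.
  exists (d / 2) => [|x' y' xd yd]; first by rewrite divr_gt0.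
  have nd := normc_le_abs (x' - x) (y' - y).
  have wd : Normc.normc (Complex (x' - x) (y' - y)) < d by apply: (le_lt_trans nd); lra.
  have := H _ wd.
  rewrite (_ : Complex (x' - x) (y' - y) + z = Complex x' y' :> CC R); last first.
    by rewrite /z; congr Complex; rewrite subrK.
  move/le_trans; apply; apply: ler_wpM2l => //; exact: ltW.
have ReE x' y' : F x' y' - F x y - (a x y * (x' - x) + - b x y * (y' - y)) =
    complex.Re (p (Complex x' y') - p z - derive1 p z * Complex (x' - x) (y' - y)).
  rewrite /F /a /b -/z; case: (p _) => ? ?; case: (p z) => ? ?.
  by case: (derive1 p z) => ? ? /=; ring.
have ImE x' y' : G x' y' - G x y - (b x y * (x' - x) + a x y * (y' - y)) =
    complex.Im (p (Complex x' y') - p z - derive1 p z * Complex (x' - x) (y' - y)).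
  rewrite /G /a /b -/z; case: (p _) => ? ?; case: (p z) => ? ?.
  by case: (derive1 p z) => ? ? /=; ring.
split=> e e0; have [d d0 H] := key e e0; exists d => // x' y' xd yd.
  by rewrite ReE; apply: le_trans (H _ _ xd yd); exact: absRe_le_normc.
by rewrite ImE; apply: le_trans (H _ _ xd yd); exact: absIm_le_normc.
Qed.

Let F0 (x y : R) : x ^+ 2 + y ^+ 2 < 1 -> 0 < F x y.
Proof. by move=> xy; apply: hp.2; exact: in_disc. Qed.

Let q (x y : R) : R := F x y ^+ 2 + G x y ^+ 2.

Let q0 (x y : R) : x ^+ 2 + y ^+ 2 < 1 -> 0 < q x y.
Proof. by move=> xy; rewrite ltr_wpDr ?sqr_ge0// exprn_gt0// F0. Qed.

Let logabs (x y : R) : R := 2^-1 * ln (q x y).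
(** The principal argument, because Re p > 0; the range of [atan] then yields the bound pi / 2. *)
Let arg (x y : R) : R := atan (G x y * (F x y)^-1).

(** The logarithmic derivative is p' / p = l - i m. *)
Let l (x y : R) : R := (F x y * a x y + G x y * b x y) / q x y.
Let m (x y : R) : R := (- F x y * b x y + G x y * a x y) / q x y.

Let fdiff_logabs (x y : R) : x ^+ 2 + y ^+ 2 < 1 -> fdiff logabs x y (l x y) (m x y).
Proof.
move=> xy; have [hF hG] := cartesian xy.
have hq := fdiffD (fdiffM hF hF) (fdiffM hG hG).
have hl := @fdiff_fun1 R (@ln R) q x y (q x y)^-1 _ _ (is_derive1_ln (q0 xy)) hq.
have := fdiffM (fdiff_cst 2^-1 x y) hl.
by congr fdiff; rewrite /l /m; field; rewrite gt_eqF// q0.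
Qed.

Let fdiff_arg (x y : R) : x ^+ 2 + y ^+ 2 < 1 -> fdiff arg x y (- m x y) (l x y).
Proof.
move=> xy; have [hF hG] := cartesian xy; have f0 : F x y != 0 by rewrite gt_eqF// F0.
have dV : is_derive (F x y) 1 (fun x : R => x^-1) (- (F x y) ^- 2 * 1).
  exact: (@is_deriveV R id (F x y) 1 1 f0 (is_derive_id _ _)).
have hV := fdiff_fun1 dV hF.
have hM := fdiffM hG hV.
have := @fdiff_fun1 R (@atan R) (fun x y => G x y * (F x y)^-1) x y _ _ _
  (is_derive1_atan (G x y * (F x y)^-1)) hM.
have q1 : q x y != 0 by rewrite gt_eqF// q0.
have q2 : 1 + (G x y * (F x y)^-1) ^+ 2 = q x y / F x y ^+ 2 by rewrite /q; field.
by congr fdiff; rewrite q2 /l /m; field; rewrite f0 q1.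
Qed.

Let X (s t : R) : R := expR s * cos t.
Let Y (s t : R) : R := expR s * sin t.

Let XY2 s t : X s t ^+ 2 + Y s t ^+ 2 = expR s ^+ 2.
Proof. by rewrite /X /Y !exprMn -mulrDr cos2Dsin2 mulr1. Qed.

Let XY1 (s t : R) : s < 0 -> X s t ^+ 2 + Y s t ^+ 2 < 1.
Proof. by move=> s0; rewrite XY2 expr_lt1 ?expR_ge0// expR_lt1. Qed.

Let fdiff_X s t : fdiff X s t (X s t) (- Y s t).
Proof.
have he := @fdiff_fun1 R (@expR R) (fun x _ => x) s t _ _ _ (is_derive_expR s) (fdiff_fst s t).
have hc := @fdiff_fun1 R (@cos R) (fun _ y => y) s t _ _ _ (is_derive_cos t) (fdiff_snd s t).
by have := fdiffM he hc; congr fdiff; rewrite /X /Y; ring.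
Qed.

Let fdiff_Y s t : fdiff Y s t (Y s t) (X s t).
Proof.
have he := @fdiff_fun1 R (@expR R) (fun x _ => x) s t _ _ _ (is_derive_expR s) (fdiff_fst s t).
have hc := @fdiff_fun1 R (@sin R) (fun _ y => y) s t _ _ _ (is_derive_sin t) (fdiff_snd s t).
by have := fdiffM he hc; congr fdiff; rewrite /X /Y; ring.
Qed.

Let L (s t : R) : R := logabs (X s t) (Y s t).
Let v (s t : R) : R := arg (X s t) (Y s t).
(** At z = X + i Y one has z p' / p = L1 + i v1, which is the s-derivative of log p along z = exp (s
    + i t). *)
Let L1 (s t : R) : R := l (X s t) (Y s t) * X s t + m (X s t) (Y s t) * Y s t.
Let v1 (s t : R) : R := - m (X s t) (Y s t) * X s t + l (X s t) (Y s t) * Y s t.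

Let fdiff_L (s t : R) : s < 0 -> fdiff L s t (L1 s t) (- v1 s t).
Proof.
move=> s0; have := fdiff_comp (fdiff_logabs (XY1 t s0)) (fdiff_X s t) (fdiff_Y s t).
by congr fdiff; rewrite /v1; ring.
Qed.

Let fdiff_v (s t : R) : s < 0 -> fdiff v s t (v1 s t) (L1 s t).
Proof.
move=> s0; have := fdiff_comp (fdiff_arg (XY1 t s0)) (fdiff_X s t) (fdiff_Y s t).
by congr fdiff; rewrite /L1; ring.
Qed.

Let periodicX (s t : R) : X s (t + 2 * pi) = X s t.
Proof. by rewrite /X mulr_natl cosD2pi. Qed.

Let periodicY (s t : R) : Y s (t + 2 * pi) = Y s t.
Proof. by rewrite /Y mulr_natl sinD2pi. Qed.

Let integrandE (s t : R) : s < 0 ->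
  Normc.normc (polar (expR s) t * derive1 p (polar (expR s) t) / p (polar (expR s) t)) ^+ 2
  = v1 s t ^+ 2 + L1 s t ^+ 2.
Proof.
move=> s0; have z1 := XY1 t s0; have q1 := q0 z1.
rewrite Normc.normcM Normc.normcM Normc.normcV !exprMn exprVn !sqr_normcE.
rewrite /= -/(X s t) -/(Y s t) -/(a _ _) -/(b _ _) -/(F _ _) -/(G _ _) -/(q _ _).
rewrite /v1 /L1 /l /m; move: q1; rewrite /q => q1.
by field; rewrite gt_eqF.
Qed.

(** Differentiability of p at the centre itself enters here: log |p| is Lipschitz at 0, and exp (s +
    i t) tends to 0 as s tends to -oo, uniformly in t. *)
Let bounded_near_centre : exists M S0, S0 < 0 /\
  forall s t : R, s <= S0 -> `|L s t| <= M /\ `|v s t| <= M.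
Proof.
have z0 : (0 : R) ^+ 2 + 0 ^+ 2 < 1 by rewrite expr0n addr0 ltr01.
have [d d0 H] := fdiff_lipschitz (fdiff_logabs z0).
set C := _ + 1 in H.
have C0 : 0 <= C by rewrite !addr_ge0.
exists (`|logabs 0 0| + C * (d + d) + pi / 2), (Num.min (-1) (ln (d / 2))).
split; first by rewrite gt_min ltrN10.
move=> s t; rewrite le_min => /andP[s1 sd].
have ed : expR s < d.
  apply: (@le_lt_trans _ _ (d / 2)); last by lra.
  by rewrite -[leRHS]lnK ?posrE ?divr_gt0// ler_expR.
have Xd : `|X s t| < d.
  apply: le_lt_trans ed; rewrite normrM (gtr0_norm (expR_gt0 s)) ler_piMr ?expR_ge0//.
  exact: cos_max.
have Yd : `|Y s t| < d.
  apply: le_lt_trans ed; rewrite normrM (gtr0_norm (expR_gt0 s)) ler_piMr ?expR_ge0//.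
  exact: sin_max.
have := H (X s t) (Y s t); rewrite !subr0 => /(_ Xd Yd) HH.
have p0 : 0 <= pi / 2 :> R by rewrite divr_ge0// pi_ge0.
split.
  rewrite /L -[X in `|X|](subrK (logabs 0 0)); apply: (le_trans (ler_normD _ _)).
  have : C * (`|X s t| + `|Y s t|) <= C * (d + d).
    by apply: ler_wpM2l => //; apply: lerD; exact: ltW.
  lra.
apply: (@le_trans _ _ (pi / 2)).
  by rewrite ler_norml /v /arg; apply/andP; split; apply: ltW;
    [exact: atan_gtNpi2|exact: atan_ltpi2].
have := normr_ge0 (logabs 0 0); have := mulr_ge0 C0 (ltW (addr_gt0 d0 d0)); lra.
Qed.

Lemma Ip_bound : exists c : nat -> R, [/\ forall i, 0 <= c i,
  forall N, \sum_(i < N) c i <= pi ^+ 2 / 2 &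
  forall s K : R, s < 0 ->
    (forall N, 2 * pi * \sum_(i < N) (i.+1%:R * expR (i.+1%:R * s)) ^+ 2 * c i <= K) ->
    Ip p (expR s) <= K].
Proof.
have [M [S0 [S00 bd]]] := bounded_near_centre.
have [||||||||c [c0 cB cK]] := @strip_energy R L v L1 v1 M S0.
- move=> s t s0; exists (L1 s t), (- v1 s t); rewrite opprK.
  by split; [exact: fdiff_L|exact: fdiff_v].
- by move=> s s0 t; rewrite /L periodicX periodicY.
- by move=> s s0 t; rewrite /v periodicX periodicY.
- exact: S00.
- exact: bd.
- move=> s t _; rewrite ler_norml /v /arg; apply/andP; split; apply: ltW.
    exact: atan_gtNpi2.
  exact: atan_ltpi2.
- by move=> s t s0; exact: fdiff_derive1 (fdiff_v t s0).
- by move=> s t s0; exact: fdiff_derive1 (fdiff_L t s0).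
exists c; split => // s K s0 HK; apply: le_trans (cK s K s0 HK).
rewrite le_eqVlt; apply/orP; left; apply/eqP.
by apply: eq_itg => t _; rewrite integrandE.
Qed.

End log_polar.

Theorem theorem1p1 (R : realType) (p : CC R -> CC R) (hp : classP p) :
  (forall r : R, 0 < r < 1 -> Ip p r <= pi ^+ 3 * expR (-2) / (1 - r) ^+ 2) /\
  ((fun r : R => (1 - r) ^+ 2 * Ip p r) @ at_left 1 --> 0).
Proof.
have [c [c0 cB cK]] := Ip_bound hp.
have pi0 : 0 < 2 * pi :> R by rewrite mulr_gt0// pi_gt0.
split=> [r /andP[r0 r1]|].
  have s0 : ln r < 0 by rewrite ln_lt0// r0.
  (* At s = ln r the two bounds combine to 2 pi * e^(-2) / (1 - r)^2 * (pi^2 / 2). *)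
  have := cK (ln r) _ s0 (fun N => ler_wpM2l (ltW pi0) (weighted_sum_le c0 cB N s0)).
  rewrite lnK ?posrE// => /le_trans; apply.
  rewrite le_eqVlt; apply/orP; left; apply/eqP.
  by move: (@pi R) => P; field; rewrite subr_eq0 gt_eqF.
apply/cvgrPdist_le => e e0.
(* The error e / (2 pi) compensates the factor 2 pi in front of the sum. *)
have [d d0 Hd] := weighted_sum_small c0 cB (divr_gt0 e0 pi0).
(* A radius at most 1 keeps r > 0, so that r = e^s with s = ln r. *)
exists (Num.min 1 d) => /=; first by rewrite lt_min ltr01.
move=> r; rewrite /ball_/= lt_min => /andP[rd1 rd] r1.
have r0 : 0 < r by move: rd1; rewrite ltr_norml => /andP[]; lra.
have s0 : ln r < 0 by rewrite ln_lt0// r0.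
have rE : expR (ln r) = r by rewrite lnK ?posrE.
have d1 : 0 < (1 - r) ^+ 2 by rewrite exprn_gt0// subr_gt0.
have Ip0 : 0 <= Ip p r by apply: Rintegral_ge0 => t _; exact: sqr_ge0.
rewrite sub0r normrN ger0_norm; last by apply: mulr_ge0 => //; exact: ltW.
rewrite mulrC -ler_pdivlMr// -{1}rE; apply: cK => // N.
rewrite ler_pdivlMr// mulrC.
have rd' : 1 - r < d by move: rd; rewrite ltr_norml => /andP[].
have := Hd _ N s0; rewrite rE => /(_ rd'); rewrite ler_pdivlMr// => H.
by rewrite [_ * \sum_(_ < _) _]mulrC mulrA.
Qed.
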